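(* Let $T$ be the $\mathcal L$-theory with axioms (1)–(8') listed in the context. If $M\models T$ and $X\subseteq M$ is infinite and definable, then $X$ has nonempty interior (in the order topology); yet $T$ is not weakly o-minimal.
   Context: Let $\mathcal L$ be the language with a binary function $+$, a binary relation $<$, a constant $0$, unary functions $s_q$ ($q\in\mathbb Q$), a unary predicate $P$, and binary predicates $R_n$ ($n\in\omega$, including $n=0$). $T$ is the $\mathcal L$-theory with the following axioms. (1) The usual axioms for a (nontrivial) ordered divisible Abelian group in $\{+,<,0\}$, and $s_q$ is scalar multiplication by $q$. (2) $0\in P$. (3) $x\in P$ if and only if $-x\in P$. (4) $P$ and $\neg P$ are open sets (in the order topology). (5) If $x\le y$ and $[x,y]\subseteq P$, then any $\mathbb Q$-linear combination $z$ of $x$ and $y$ with positive coefficients lies in the same connected (i.e. maximal convex) component of $P$ as $x$ and $y$. (5') If $x\le y$ and $[x,y]\subseteq\neg P$, then any $\mathbb Q$-linear combination $z$ of $x$ and $y$ with positive coefficients lies in the same connected component of $\neg P$ as $x$ and $y$. (6) $R_0$ is symmetric, and if $x\le y$ then $R_0(x,y)$ holds iff $[x,y]\subseteq P$ or $[x,y]\subseteq\neg P$. (7) For all $x,y$ and each positive $n<\omega$, $R_n(x,y)$ holds iff $x<y$ and there are exactly $n$ alternations of $P$ between $x$ and $y$; that is, either (A) $x\in P$ and there is a sequence $x=x_0<x_1<\dots<x_n=y$ with $x_i\in P$ iff $i$ is even, but there is no sequence $x=x_0<x_1<\dots<x_{n+1}\le y$ with $x_i\in P$ iff $i$ is even;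 or (B) $x\notin P$ and there is a sequence $x=x_0<x_1<\dots<x_n=y$ with $x_i\in P$ iff $i$ is odd, but there is no sequence $x=x_0<x_1<\dots<x_{n+1}\le y$ with $x_i\in P$ iff $i$ is odd. (8) For any positive $x$ there is $y$ with $R_1(x,y)$. (8') For any positive $x$ there is $y$ with $R_1(y,x)$. Definable means definable with parameters. A theory is weakly o-minimal if in each of its models every definable subset of the model is a finite union of convex sets. *)

(* Defs.v *)
From mathcomp Require Import all_boot all_order all_algebra.
From mathcomp Require Import all_classical.

Set Implicit Arguments.
Unset Strict Implicit.
Unset Printing Implicit Defensive.

Import Order.TTheory GRing.Theory Num.Theory.
Local Open Scope ring_scope.
Local Open Scope classical_set_scope.

Inductive term : Type :=
| Var of nat
| Zero
| Add of term & term
| Scale of rat & term.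

Inductive formula : Type :=
| Eq of term & term
| Lt of term & term
| InP of term
| Rel of nat & term & term
| Neg of formula
| And of formula & formula
| Or of formula & formula
| Imp of formula & formula
| All of nat & formula
| Ex of nat & formula.

Record structure : Type := Structure {
  carrier :> Type;
  zeroI : carrier;
  addI : carrier -> carrier -> carrier;
  scaleI : rat -> carrier -> carrier;
  ltI : carrier -> carrier -> Prop;
  PI : set carrier;
  RI : nat -> carrier -> carrier -> Prop }.

Arguments zeroI {s}.
Arguments addI {s}.
Arguments scaleI {s}.
Arguments ltI {s}.
Arguments PI {s}.
Arguments RI {s}.

Definition update (A : Type) (rho : nat -> A) (i : nat) (a : A) : nat -> A :=
  fun j => if j == i then a else rho j.

Fixpoint eval (M : structure) (rho : nat -> M) (t : term) : M :=
  match t with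
  | Var i => rho i
  | Zero => zeroI
  | Add t u => addI (eval rho t) (eval rho u)
  | Scale q t => scaleI q (eval rho t)
  end.

Fixpoint sat (M : structure) (rho : nat -> M) (f : formula) : Prop :=
  match f with
  | Eq t u => eval rho t = eval rho u
  | Lt t u => ltI (eval rho t) (eval rho u)
  | InP t => PI (eval rho t)
  | Rel n t u => RI n (eval rho t) (eval rho u)
  | Neg f => ~ sat rho f
  | And f g => sat rho f /\ sat rho g
  | Or f g => sat rho f \/ sat rho g
  | Imp f g => sat rho f -> sat rho g
  | All i f => forall a, sat (update rho i a) f
  | Ex i f => exists a, sat (update rho i a) f
  end.

(* Free variables, if any, are read as universally quantified. *)
Definition models (M : structure) (Th : set formula) : Prop :=
  forall f, Th f -> forall rho : nat -> M, sat rho f.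

(* The values [rho i] for [i > 0] are the parameters. *)
Definition definable (M : structure) (X : set M) : Prop :=
  exists (f : formula) (rho : nat -> M), X = [set a | sat (update rho 0%N a) f].

Definition leI (M : structure) (a b : M) : Prop := ltI a b \/ a = b.

Definition cc_interval (M : structure) (a b : M) : set M :=
  [set c | leI a c /\ leI c b].

Definition convex (M : structure) (C : set M) : Prop :=
  forall a b, C a -> C b -> cc_interval a b `<=` C.

Definition finite_union_of_convex (M : structure) (X : set M) : Prop :=
  exists (n : nat) (C : 'I_n -> set M),
    (forall i, convex (C i)) /\ X = \bigcup_(i in [set: 'I_n]) C i.

Definition weakly_o_minimal (Th : set formula) : Prop :=
  forall M : structure, models M Th ->
  forall X : set M, definable X -> finite_union_of_convex X.

(* Open intervals and rays; [None] stands for an infinite endpoint. *)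
Definition oo_interval (M : structure) (lo hi : option M) : set M :=
  [set c | (if lo is Some a then ltI a c else True) /\
           (if hi is Some b then ltI c b else True)].

Definition order_open (M : structure) (U : set M) : Prop :=
  forall c, U c -> exists lo hi : option M,
    oo_interval lo hi c /\ oo_interval lo hi `<=` U.

Definition order_interior (M : structure) (X : set M) : set M :=
  [set c | exists U : set M, [/\ order_open U, U `<=` X & U c]].

Definition component (M : structure) (A C : set M) : Prop :=
  [/\ C !=set0, convex C, C `<=` A &
      forall D, convex D -> C `<=` D -> D `<=` A -> D `<=` C].

Definition same_component (M : structure) (A : set M) (a b : M) : Prop :=
  exists C, [/\ component A C, C a & C b].

Declare Scope fo_scope.
Delimit Scope fo_scope with fo.
Bind Scope fo_scope with term formula.
Notation "''X_' i" := (Var i) : fo_scope.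
Notation "0" := Zero : fo_scope.
Notation "t + u" := (Add t u) : fo_scope.
Notation "q *: t" := (Scale q%R t) : fo_scope.
Notation "t == u" := (Eq t u) : fo_scope.
Notation "t != u" := (Neg (Eq t u)) : fo_scope.
Notation "t < u" := (Lt t u) : fo_scope.
Notation "t <= u" := (Or (Lt t u) (Eq t u)) : fo_scope.
Notation "~ f" := (Neg f) : fo_scope.
Notation "f /\ g" := (And f g) : fo_scope.
Notation "f \/ g" := (Or f g) : fo_scope.
Notation "f -> g" := (Imp f g) : fo_scope.
Notation "f <-> g" := (And (Imp f g) (Imp g f)) : fo_scope.
Notation "''forall' ''X_' i , f" := (All i f) : fo_scope.
Notation "''exists' ''X_' i , f" := (Ex i f) : fo_scope.

Definition nmul_term (n : nat) (t : term) : term := iter n (Add t) Zero.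

Definition conj_fo (fs : seq formula) : formula := foldr And (Eq Zero Zero) fs.

Definition exs_fo (vs : seq nat) (f : formula) : formula := foldr Ex f vs.

(* [colored true] is P and [colored false] is its complement. *)
Definition colored (c : bool) (t : term) : formula :=
  if c then InP t else Neg (InP t).

(* [t, u] is contained in P (resp. in its complement); 'X_9 is a bound variable
   that must not occur in [t] or [u]. *)
Definition itv_colored (c : bool) (t u : term) : formula :=
  ('forall 'X_9, (t <= 'X_9 /\ 'X_9 <= u) -> colored c 'X_9)%fo.

(* First-order rendering of [same_component]; see [same_componentP]. *)
Definition same_component_fo (c : bool) (t u : term) : formula :=
  (itv_colored c t u /\ itv_colored c u t)%fo.

(* There are 'X_0 = 'X_2 < 'X_3 < ... < 'X_(n+2) with 'X_(i+2) in P iff i is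
   even (if [c]) or odd (if not), and with [last] holding of 'X_(n+2). *)
Definition alternation (c : bool) (n : nat) (last : formula) : formula :=
  exs_fo (iota 2 n.+1)
    (('X_2 == 'X_0 /\
     conj_fo [seq 'X_(i.+2) < 'X_(i.+3) | i <- iota 0 n]) /\
     (conj_fo [seq colored (c (+) odd i) 'X_(i.+2) | i <- iota 0 n.+1] /\
     last))%fo.

Definition alternations_exactly (c : bool) (n : nat) : formula :=
  (colored c 'X_0 /\
   (alternation c n ('X_(n.+2) == 'X_1) /\
    ~ alternation c n.+1 ('X_(n.+3) <= 'X_1)))%fo.

Local Open Scope fo_scope.

Inductive T : formula -> Prop :=
| T_addA : T ('forall 'X_0, 'forall 'X_1, 'forall 'X_2,
    'X_0 + ('X_1 + 'X_2) == ('X_0 + 'X_1) + 'X_2)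
| T_addC : T ('forall 'X_0, 'forall 'X_1, 'X_0 + 'X_1 == 'X_1 + 'X_0)
| T_add0 : T ('forall 'X_0, 0 + 'X_0 == 'X_0)
| T_opp : T ('forall 'X_0, 'exists 'X_1, 'X_0 + 'X_1 == 0)
| T_nontrivial : T ('exists 'X_0, 'X_0 != 0)
| T_divisible n : (0 < n)%N ->
    T ('forall 'X_0, 'exists 'X_1, nmul_term n 'X_1 == 'X_0)
| T_lt_irr : T ('forall 'X_0, ~ ('X_0 < 'X_0))
| T_lt_trans : T ('forall 'X_0, 'forall 'X_1, 'forall 'X_2,
    ('X_0 < 'X_1 /\ 'X_1 < 'X_2) -> 'X_0 < 'X_2)
| T_lt_total : T ('forall 'X_0, 'forall 'X_1,
    'X_0 < 'X_1 \/ ('X_0 == 'X_1 \/ 'X_1 < 'X_0))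
| T_lt_add : T ('forall 'X_0, 'forall 'X_1, 'forall 'X_2,
    'X_0 < 'X_1 -> 'X_0 + 'X_2 < 'X_1 + 'X_2)
| T_scale1 : T ('forall 'X_0, 1 *: 'X_0 == 'X_0)
| T_scaleA (q r : rat) : T ('forall 'X_0, q *: (r *: 'X_0) == (q * r) *: 'X_0)
| T_scaleDl (q r : rat) : T ('forall 'X_0,
    (q + r) *: 'X_0 == q *: 'X_0 + r *: 'X_0)
| T_scaleDr (q : rat) : T ('forall 'X_0, 'forall 'X_1,
    q *: ('X_0 + 'X_1) == q *: 'X_0 + q *: 'X_1)
| T_P0 : T (InP 0)
| T_Popp : T ('forall 'X_0, InP 'X_0 <-> InP ((-1) *: 'X_0))
  (* c = true: P is open; c = false: its complement is open *)
| T_open c : T ('forall 'X_0, colored c 'X_0 ->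
    'exists 'X_1, 'exists 'X_2, ('X_1 < 'X_0 /\ 'X_0 < 'X_2) /\
      'forall 'X_3, ('X_1 < 'X_3 /\ 'X_3 < 'X_2) -> colored c 'X_3)
| T_comp c (q r : rat) : (0 < q)%R -> (0 < r)%R ->
    T ('forall 'X_0, 'forall 'X_1,
      ('X_0 <= 'X_1 /\ itv_colored c 'X_0 'X_1) ->
      (same_component_fo c (q *: 'X_0 + r *: 'X_1) 'X_0 /\
       same_component_fo c (q *: 'X_0 + r *: 'X_1) 'X_1))
| T_R0_sym : T ('forall 'X_0, 'forall 'X_1, Rel 0 'X_0 'X_1 -> Rel 0 'X_1 'X_0)
| T_R0 : T ('forall 'X_0, 'forall 'X_1, 'X_0 <= 'X_1 ->
    (Rel 0 'X_0 'X_1 <->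
     (itv_colored true 'X_0 'X_1 \/ itv_colored false 'X_0 'X_1)))
| T_R n : (0 < n)%N -> T ('forall 'X_0, 'forall 'X_1,
    Rel n 'X_0 'X_1 <->
    ('X_0 < 'X_1 /\
     (alternations_exactly true n \/ alternations_exactly false n)))
| T_R1_above : T ('forall 'X_0, 0 < 'X_0 -> 'exists 'X_1, Rel 1 'X_0 'X_1)
| T_R1_below : T ('forall 'X_0, 0 < 'X_0 -> 'exists 'X_1, Rel 1 'X_1 'X_0).

Local Close Scope fo_scope.

(* The axioms as conditions on a structure; [models_TP] shows that they are
   what the sentences of [T] express. *)
Definition colorI (M : structure) (c : bool) : set M :=
  if c then PI else ~` PI.

(* x = s 0 < ... < s n with s i in P iff i is even (c = true) or odd *)
Definition alternating (M : structure) (c : bool) (n : nat) (x : M)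
    (s : nat -> M) : Prop :=
  [/\ s 0%N = x, forall i, (i < n)%N -> ltI (s i) (s i.+1) &
      forall i, (i <= n)%N -> (PI (s i) <-> c (+) odd i)].

Definition alternations (M : structure) (c : bool) (n : nat) (x y : M) : Prop :=
  [/\ colorI c x, exists s, alternating c n x s /\ s n = y &
      ~ exists s, alternating c n.+1 x s /\ leI (s n.+1) y].

Record T_axioms (M : structure) : Prop := TAxioms {
  ax_addA : forall x y z : M, addI x (addI y z) = addI (addI x y) z;
  ax_addC : forall x y : M, addI x y = addI y x;
  ax_add0 : forall x : M, addI zeroI x = x;
  ax_opp : forall x : M, exists y, addI x y = zeroI;
  ax_nontrivial : exists x : M, x <> zeroI;
  ax_divisible : forall n, (0 < n)%N ->
    forall x : M, exists y, iter n (addI y) zeroI = x;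
  ax_lt_irr : forall x : M, ~ ltI x x;
  ax_lt_trans : forall x y z : M, ltI x y -> ltI y z -> ltI x z;
  ax_lt_total : forall x y : M, [\/ ltI x y, x = y | ltI y x];
  ax_lt_add : forall x y z : M, ltI x y -> ltI (addI x z) (addI y z);
  ax_scale1 : forall x : M, scaleI 1 x = x;
  ax_scaleA : forall q r (x : M), scaleI q (scaleI r x) = scaleI (q * r) x;
  ax_scaleDl : forall q r (x : M),
    scaleI (q + r) x = addI (scaleI q x) (scaleI r x);
  ax_scaleDr : forall q (x y : M),
    scaleI q (addI x y) = addI (scaleI q x) (scaleI q y);
  ax_P0 : PI (zeroI : M);
  ax_Popp : forall x y : M, addI x y = zeroI -> (PI x <-> PI y);
  ax_open : forall c, order_open (@colorI M c);
  ax_comp : forall c (q r : rat), 0 < q -> 0 < r ->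
    forall x y : M, leI x y -> cc_interval x y `<=` colorI c ->
    same_component (colorI c) (addI (scaleI q x) (scaleI r y)) x /\
    same_component (colorI c) (addI (scaleI q x) (scaleI r y)) y;
  ax_R0_sym : forall x y : M, RI 0 x y -> RI 0 y x;
  ax_R0 : forall x y : M, leI x y ->
    (RI 0 x y <-> cc_interval x y `<=` PI \/ cc_interval x y `<=` ~` PI);
  ax_R : forall n, (0 < n)%N -> forall x y : M,
    RI n x y <-> ltI x y /\ (alternations true n x y \/ alternations false n x y);
  ax_R1_above : forall x : M, ltI zeroI x -> exists y, RI 1 x y;
  ax_R1_below : forall x : M, ltI zeroI x -> exists y, RI 1 y x }.

Lemma sat_And (M : structure) (rho : nat -> M) f g :
  sat rho (And f g) = (sat rho f /\ sat rho g).
Proof. by []. Qed.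

Lemma sat_conj_fo (M : structure) (rho : nat -> M) (F : nat -> formula) n :
  sat rho (conj_fo [seq F i | i <- iota 0 n]) <->
  forall i, (i < n)%N -> sat rho (F i).
Proof.
have E (r : seq nat) : sat rho (conj_fo [seq F i | i <- r]) <->
    forall i, i \in r -> sat rho (F i).
  elim: r => [|j r IH] /=; first by split.
  split=> [[Fj /IH Fr] i|Fr].
    by rewrite in_cons => /orP[/eqP ->|/Fr].
  split; first by apply: Fr; rewrite in_cons eqxx.
  by apply/IH => i ri; apply: Fr; rewrite in_cons ri orbT.
by split=> [/E H i lin|H]; [apply: H|apply/E => i; move: (H i)];
  rewrite mem_iota add0n.
Qed.

Lemma sat_exs_fo (M : structure) (rho : nat -> M) vs f :
  sat rho (exs_fo vs f) <->
  exists sg : nat -> M, (forall i, i \notin vs -> sg i = rho i) /\ sat sg f.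
Proof.
elim: vs rho => [|v vs IH] rho /=.
  split=> [H|[sg [Hsg]]]; first by exists rho.
  by rewrite (_ : sg = rho) //; apply/funext => i; exact: Hsg.
split=> [[a /IH [sg [Hsg Hf]]]|[sg [Hsg Hf]]].
  exists sg; split=> // i; rewrite in_cons negb_or => /andP[iv ivs].
  by rewrite Hsg // /update (negPf iv).
exists (sg v); apply/IH; exists sg; split=> // i ivs; rewrite /update.
by case: eqP => [->//|/eqP iv]; apply: Hsg; rewrite in_cons negb_or iv.
Qed.

Lemma sat_colored (M : structure) (rho : nat -> M) c t :
  sat rho (colored c t) <-> colorI c (eval rho t).
Proof. by case: c. Qed.

Lemma colorIP (M : structure) (c : bool) (a : M) : colorI c a <-> (PI a <-> c).
Proof.
case: c; rewrite /colorI /=; first by split=> [Pa|H]; [split|apply/H].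
by split=> [na|[na _] /na]//; split.
Qed.

Lemma sat_alternation (M : structure) (rho : nat -> M) c n f (Q : M -> Prop) :
  (forall sg : nat -> M, sg 1%N = rho 1%N -> (sat sg f <-> Q (sg n.+2))) ->
  sat rho (alternation c n f) <->
  exists s, alternating c n (rho 0%N) s /\ Q (s n).
Proof.
move=> fQ; split=> [/sat_exs_fo[sg [Hsg]]|[s [[s0 slt sP] sQ]]].
  have [sg0 sg1] : sg 0%N = rho 0%N /\ sg 1%N = rho 1%N by
    split; apply: Hsg; rewrite mem_iota.
  rewrite 3!sat_And => -[[sg2 /sat_conj_fo slt] [/sat_conj_fo sP sQ]].
  exists (fun i => sg i.+2); split; last exact/fQ.
  split=> [|//|i lin]; first by rewrite -sg0.
  by have /sat_colored/colorIP := sP i lin.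
apply/sat_exs_fo.
exists (fun i => if i is j.+2 then
  if (j <= n)%N then s j else rho i else rho i); split.
  move=> [|[|j]] //; rewrite mem_iota /= !add2n !ltnS leqNgt.
  by case: ltnP.
rewrite 3!sat_And; split; last split.
- split; first by [].
  by apply/sat_conj_fo => i lin /=; rewrite lin ltnW //; exact: slt.
- apply/sat_conj_fo => i lin; apply/sat_colored/colorIP => /=.
  by rewrite -ltnS lin; apply: sP.
- by apply/fQ => //=; rewrite leqnn.
Qed.

Lemma sat_alternations (M : structure) (rho : nat -> M) c n :
  sat rho (alternations_exactly c n) <-> alternations c n (rho 0%N) (rho 1%N).
Proof.
have A1 := @sat_alternation M rho c n ('X_(n.+2) == 'X_1)%fo
  (fun z => z = rho 1%N).
have A2 := @sat_alternation M rho c n.+1 ('X_(n.+3) <= 'X_1)%fo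
  (fun z => leI z (rho 1%N)).
rewrite /alternations_exactly [sat _ _]/=; split.
  case=> /sat_colored ? [/A1 H1 H2]; split=> //.
    by apply: H1 => sg /= ->.
  by move=> H; apply: H2; apply/A2 => // sg /= ->.
case=> c0 H1 H2; split; first exact/sat_colored.
split; first by apply/A1 => // sg /= ->.
by move=> /A2 H; apply: H2; apply: H => sg /= ->.
Qed.

Lemma same_componentP (M : structure) (A : set M) (a b : M) :
  (forall x y z : M, ltI x y -> ltI y z -> ltI x z) ->
  (forall x y : M, [\/ ltI x y, x = y | ltI y x]) ->
  same_component A a b <-> cc_interval a b `<=` A /\ cc_interval b a `<=` A.
Proof.
move=> ltT tot.
have leT (x y z : M) : leI x y -> leI y z -> leI x z.
  by move=> [xy|->] // [yz|<-]; left => //; exact: ltT xy yz.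
have leR (x : M) : leI x x by right.
have leV (x y : M) : leI x y \/ leI y x.
  by case: (tot x y) => [xy|->|yx]; [left; left|left|right; left].
split=> [[C [[_ Cc CA _] Ca Cb]]|[abA baA]].
  by split; apply: (subset_trans _ CA); exact: Cc.
pose L (x y : M) := cc_interval x y `<=` A /\ cc_interval y x `<=` A.
have Lsym x y : L x y -> L y x by case.
have Ltr x y z : L x y -> L y z -> L x z.
  move=> [xy yx] [yz zy]; split=> w [h1 h2].
    case: (leV w y) => wy; first by apply: xy.
    by apply: yz.
  case: (leV w y) => wy; first by apply: zy.
  by apply: yx.
have Lself x y : L x y -> A x.
  by move=> [xy yx]; case: (leV x y) => h; [apply: xy|apply: yx]; split.
have Laa : L a a by apply: (Ltr _ b).
exists [set c | L a c]; split=> //; split.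
- by exists a.
- move=> x y ax ay w [xw wy].
  have xy := Ltr _ _ _ (Lsym _ _ ax) ay.
  apply: (Ltr _ _ _ ax); split=> v [h1 h2]; apply: xy.1; split=> //.
  + exact: leT h2 wy.
  + exact: leT xw h1.
  + exact: leT h2 (leT _ _ _ _ wy).
- by move=> x /Lsym /Lself.
- move=> D Dc CD DA x Dx; have Da : D a by exact: CD.
  by split; apply: (subset_trans _ DA); exact: Dc.
Qed.

Lemma oo_interval_bounded (M : structure) (c : M) (U : set M) :
  (forall x y z : M, ltI x y -> ltI y z -> ltI x z) ->
  (forall x y : M, [\/ ltI x y, x = y | ltI y x]) ->
  (exists l : M, ltI l c) -> (exists h : M, ltI c h) ->
  (exists lo hi : option M, oo_interval lo hi c /\ oo_interval lo hi `<=` U) ->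
  exists l h : M, (ltI l c /\ ltI c h) /\
    forall w, ltI l w /\ ltI w h -> U w.
Proof.
move=> ltT tot [l0 l0c] [h0 ch0] [lo [hi [[loc chi] sub]]].
exists (odflt l0 lo), (odflt h0 hi); split.
  by case: lo hi loc chi {sub} => [?|] [?|].
move=> w [lw wh]; apply: sub.
by case: lo hi {loc chi} lw wh => [?|] [?|].
Qed.

Lemma ord_opp (M : structure) :
  (forall x y z : M, addI x (addI y z) = addI (addI x y) z) ->
  (forall x y : M, addI x y = addI y x) ->
  (forall x : M, addI zeroI x = x) ->
  (forall x : M, exists y, addI x y = zeroI) ->
  (forall x : M, scaleI 1 x = x) ->
  (forall q r (x : M), scaleI (q + r) x = addI (scaleI q x) (scaleI r x)) ->
  forall x y : M, addI x y = zeroI <-> scaleI (-1) x = y.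
Proof.
move=> aA aC a0 aN s1 sD x.
have cancel (u v w : M) : addI u v = addI u w -> v = w.
  move=> e; have [u' uu'] := aN u.
  by rewrite -(a0 v) -(a0 w) -uu' (aC u) -!aA e.
have s0 : scaleI 0 x = zeroI.
  by apply: (cancel (scaleI 0 x)); rewrite -sD addr0 aC a0.
have sN : addI x (scaleI (-1) x) = zeroI by rewrite -{1}(s1 x) -sD subrr.
by move=> y; split=> [e|<-//]; apply: (cancel x); rewrite sN.
Qed.

Lemma no_endpoints (M : structure) :
  (forall x y : M, addI x y = addI y x) ->
  (forall x : M, addI zeroI x = x) ->
  (forall x : M, exists y, addI x y = zeroI) ->
  (exists x : M, x <> zeroI) ->
  (forall x y : M, [\/ ltI x y, x = y | ltI y x]) ->
  (forall x y z : M, ltI x y -> ltI (addI x z) (addI y z)) ->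
  forall c : M, (exists l : M, ltI l c) /\ (exists h : M, ltI c h).
Proof.
move=> aC a0 aN [d dN0] tot ltD c.
have [e de] := aN d.
have ends (u v : M) : addI u v = zeroI -> ltI u zeroI ->
    (exists l, ltI l c) /\ (exists h, ltI c h).
  move=> uv u0; have v0 : ltI zeroI v.
    by rewrite -uv -{2}(a0 v); exact: ltD.
  split; [exists (addI u c)|exists (addI v c)].
    by rewrite -{2}(a0 c); exact: ltD.
  by rewrite -{1}(a0 c); exact: ltD.
have [d0|//|d0] := tot d zeroI; first exact: ends de d0.
by apply: (ends e d); [rewrite aC|rewrite -de -{1}(a0 e); exact: ltD].
Qed.

Lemma sat_itv_colored (M : structure) (rho : nat -> M) (c : bool) i j :
  (i != 9)%N -> (j != 9)%N ->
  sat rho (itv_colored c 'X_i 'X_j) <-> cc_interval (rho i) (rho j) `<=` colorI c.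
Proof.
move=> /negPf i9 /negPf j9; rewrite /= /update i9 j9 /=.
by split=> H w /H; case: c {H}.
Qed.

Lemma eval_nmul_term (M : structure) (rho : nat -> M) n t :
  eval rho (nmul_term n t) = iter n (addI (eval rho t)) zeroI.
Proof. by elim: n => //= n ->. Qed.

Lemma models_TP (M : structure) : models M T <-> T_axioms M.
Proof.
split=> [H|A].
  pose r (_ : nat) : M := zeroI.
  have aA := H _ T_addA r : forall x y z : M, addI x (addI y z) = addI (addI x y) z.
  have aC := H _ T_addC r : forall x y : M, addI x y = addI y x.
  have a0 := H _ T_add0 r : forall x : M, addI zeroI x = x.
  have aN := H _ T_opp r : forall x : M, exists y, addI x y = zeroI.
  have ltT (x y z : M) : ltI x y -> ltI y z -> ltI x z.
    by move=> xy yz; apply: (H _ T_lt_trans r x y z).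
  have tot (x y : M) : [\/ ltI x y, x = y | ltI y x].
    by case: (H _ T_lt_total r x y) => [|[|]] /= ?; [apply: Or31|apply: Or32|apply: Or33].
  split=> //.
  - exact: H _ T_nontrivial r.
  - move=> n n0 x; have [y xy] := H _ (T_divisible n0) r x; exists y.
    by rewrite -(eval_nmul_term (update (update r 0%N x) 1%N y) n 'X_1%fo).
  - exact: H _ T_lt_irr r.
  - exact: H _ T_lt_add r.
  - exact: H _ T_scale1 r.
  - by move=> q s; exact: H _ (T_scaleA q s) r.
  - by move=> q s; exact: H _ (T_scaleDl q s) r.
  - by move=> q; exact: H _ (T_scaleDr q) r.
  - exact: H _ T_P0 r.
  - have oppP := ord_opp aA aC a0 aN (H _ T_scale1 r)
      (fun q s => H _ (T_scaleDl q s) r).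
    by move=> x y /oppP <-; exact: H _ T_Popp r x.
  - move=> c x cx.
    have [|l [h [/= [lx xh] sub]]] := H _ (T_open c) r x; first exact/sat_colored.
    exists (Some l), (Some h); split=> // w lwh.
    by have /sat_colored := sub w lwh.
  - move=> c p q p0 q0 x y xy sub.
    have [|[h1 h2] [h3 h4]] := H _ (T_comp c p0 q0) r x y.
      by split=> //; apply/sat_itv_colored.
    by split; apply/same_componentP => //; split=> w hw;
      apply/(sat_colored (update r 0%N w) c 'X_0); move: hw;
      [move: (h1 w)|move: (h2 w)|move: (h3 w)|move: (h4 w)]; case: (c).
  - exact: H _ T_R0_sym r.
  - move=> x y xy; have [h1 h2] := H _ T_R0 r x y xy.
    have L c := @sat_itv_colored M (update (update r 0%N x) 1%N y) c 0 1 isT isT.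
    split=> [/h1 [] h|[] h].
    + by left; exact: (L true).1 h.
    + by right; exact: (L false).1 h.
    + exact: h2 (or_introl ((L true).2 h)).
    + exact: h2 (or_intror ((L false).2 h)).
  - move=> n n0 x y; have [h1 h2] := H _ (T_R n0) r x y.
    have L c := @sat_alternations M (update (update r 0%N x) 1%N y) c n.
    split=> [/h1 [xy [] h]|[xy [] h]].
    + by split=> //; left; exact: (L true).1 h.
    + by split=> //; right; exact: (L false).1 h.
    + exact: h2 (conj xy (or_introl ((L true).2 h))).
    + exact: h2 (conj xy (or_intror ((L false).2 h))).
  - exact: H _ T_R1_above r.
  - exact: H _ T_R1_below r.
case: A => aA aC a0 aN nt dv irr ltT tot ltD s1 sA sD sDr P0 PN Po Pc Rs R0 Rn up dn.
have oppP := ord_opp aA aC a0 aN s1 sD.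
move=> f Tf rho; case: f / Tf => [||||||||||||||||||||||].
- exact: aA.
- exact: aC.
- exact: a0.
- exact: aN.
- exact: nt.
- move=> n n0 x; have [y xy] := dv n n0 x; exists y.
  rewrite -[LHS]/(eval (update (update rho 0%N x) 1%N y) (nmul_term n 'X_1%fo)).
  by rewrite eval_nmul_term.
- exact: irr.
- by move=> x y z [xy yz]; exact: ltT xy yz.
- by move=> x y; case: (tot x y); [left|right; left|right; right].
- exact: ltD.
- exact: s1.
- by move=> q r; exact: sA.
- by move=> q r; exact: sD.
- by move=> q; exact: sDr.
- exact: P0.
- by move=> x; have [h1 h2] := PN x _ ((oppP _ _).2 erefl); split.
- move=> c x /sat_colored cx.
  have [l0 h0] := no_endpoints aC a0 aN nt tot ltD x.
  have [l [h [lxh sub]]] := oo_interval_bounded ltT tot l0 h0 (Po c x cx).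
  by exists l, h; split=> // w /sub /(sat_colored _ c 'X_3).
- move=> c q r q0 r0 x y [xy sub].
  have [|h1 h2] := Pc c q r q0 r0 x y xy; first exact: (sat_itv_colored _ _ _ _).1 sub.
  move: h1 h2 => /same_componentP-/(_ ltT tot) [h1 h2].
  move=> /same_componentP-/(_ ltT tot) [h3 h4].
  by split; split=> w hw; apply/sat_colored;
    [exact: h1|exact: h2|exact: h3|exact: h4].
- exact: Rs.
- move=> x y xy; have [h1 h2] := R0 x y xy.
  have L c := @sat_itv_colored M (update (update rho 0%N x) 1%N y) c 0 1 isT isT.
  split=> [/h1 [] h|[] h].
  + by left; exact: (L true).2 h.
  + by right; exact: (L false).2 h.
  + exact: h2 (or_introl ((L true).1 h)).
  + exact: h2 (or_intror ((L false).1 h)).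
- move=> n n0 x y; have [h1 h2] := Rn n n0 x y.
  have L c := @sat_alternations M (update (update rho 0%N x) 1%N y) c n.
  split=> [/h1 [xy [] h]|[xy [] h]].
  + by split=> //; left; exact: (L true).2 h.
  + by split=> //; right; exact: (L false).2 h.
  + exact: h2 (conj xy (or_introl ((L true).1 h))).
  + exact: h2 (conj xy (or_intror ((L false).1 h))).
- exact: up.
- exact: dn.
Qed.

(* Main.v *)
From HB Require Import structures.
Require Import Defs.
From mathcomp Require Import all_boot all_order all_algebra.
From mathcomp Require Import all_classical zify.

Set Implicit Arguments.
Unset Strict Implicit.
Unset Printing Implicit Defensive.
Import Order.TTheory GRing.Theory Num.Theory.
Local Open Scope ring_scope.

(** The reason is that a model M of T carries a valuation, and that everything
    definable in M is controlled by the signs and valuations of finitely many terms.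

    The valuation. The axiom ax_comp with both points equal says that the
    component of an element is stable under positive rational scaling. Hence the
    component of |x| is a valuation of x: it is stable under nonzero scaling
    (val_eq_scale) and ultrametric (val_le_add), because |x + y| is at most twice
    the larger absolute value. By ax_R1_above and ax_R1_below each value has a
    successor, and each value but the least, that of 0, is a successor; membership
    in P changes at each step (ex_succ, ex_pred). So the set of values is a discrete
    linear order with a first point and no last one, coloured alternately.

    Interiors. Two assignments of the variables are called similar for a finite
    set of terms and a bound N if corresponding values of these terms have the same
    sign and the same colour, and if corresponding valuations are the same number
    of steps apart, all numbers above N being identified. An
    Ehrenfeucht-Fraisse argument (extend_point, similar_update) shows that
    a similarity for enough terms and a large enough bound can be continued by a
    value of one more variable. By induction on formulas, the truth of each formula
    is therefore determined by finitely many terms and a bound (determined_sat); the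
    relations R_n do no harm, since the axioms define them from the order and P.
    Now let one variable vary. Each term is an affine function of it, and off the
    finitely many zeros of these functions a small change of the variable alters
    neither sign nor valuation of any of them (similar_near). So off a finite set
    membership in a definable set is locally constant (definable_interior).

    Weak o-minimality fails. Order the polynomials over the rationals by the sign of
    the leading coefficient and let P consist of those of even degree. The degree
    with the sign of the leading coefficient is a monotone map onto the integers
    whose fibres are the components, so the axioms become statements about integers
    (poly_axioms). The powers of X of even exponent lie in P and those of odd
    exponent separate them (poly_not_finite_union). *)

(** * Discrete linear orders with alternating colours *)

Lemma seq_max (T : eqType) (R : T -> T -> Prop) (Q : T -> Prop) (s : seq T) (x0 : T) :
  (forall x y, R x y \/ R y x) -> (forall x y z, R x y -> R y z -> R x z) ->
  x0 \in s -> Q x0 ->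
  exists x, [/\ x \in s, Q x & forall y, y \in s -> Q y -> R y x].
Proof.
move=> tot tr; elim: s x0 => // a s IH x0.
case: (pselect (exists2 y, y \in s & Q y)) => [[y ys Qy] _ _|nex].
  have [x [xs Qx mx]] := IH y ys Qy.
  have [[Qa xa]|h] := pselect (Q a /\ R x a).
    exists a; split; rewrite ?mem_head // => z; rewrite in_cons => /orP[/eqP ->|zs] Qz.
      by case: (tot a a).
    exact: tr (mx z zs Qz) xa.
  exists x; split; rewrite ?in_cons ?xs ?orbT // => z; rewrite in_cons.
  move=> /orP[/eqP -> Qa|zs Qz]; last exact: mx.
  by case: (tot a x) => // xa; case: h.
rewrite in_cons => /orP[/eqP -> Qa|xs Qx]; last by case: nex; exists x0.
exists a; split; rewrite ?mem_head // => z; rewrite in_cons => /orP[/eqP ->|zs] Qz.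
  by case: (tot a a).
by case: nex; exists z.
Qed.

(** The order is only a preorder: the points will be the elements of a model, and
    equivalent points those with the same valuation. *)
Section DiscreteOrder.
Variables (I : eqType) (le : I -> I -> Prop) (S : I -> I) (o : I) (col : I -> Prop).
Hypothesis le_tot : forall x y, le x y \/ le y x.
Hypothesis le_tr : forall x y z, le x y -> le y z -> le x z.
Hypothesis leS : forall x y, le (S x) y <-> ~ le y x.
Hypothesis le_o : forall x, le o x.
Hypothesis pred_ex : forall x, ~ le x o -> exists y, le (S y) x /\ le x (S y).
Hypothesis colS : forall x, col (S x) <-> ~ col x.
Hypothesis col_le : forall x y, le x y -> le y x -> (col x <-> col y).
Implicit Types (x y z : I) (m n k : nat).

(** All distances are expressed through gap, which is decreasing in n; gap 0 is the
    order and gap 1 the strict order. The distance truncated at N is then the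
    family of the gap n for n at most N. *)
Definition gap n x y := le (iter n S x) y.

Let le_r x : le x x. Proof. by case: (le_tot x x). Qed.

Lemma le_S2 x y : le (S x) (S y) <-> le x y.
Proof.
rewrite leS; split=> [h|h /leS]; last exact.
by apply: contrapT => /leS.
Qed.

Lemma le_iter k x y : le (iter k S x) (iter k S y) <-> le x y.
Proof. by elim: k => //= k <-; exact: le_S2. Qed.

Lemma gap_iterl n k x y : gap n (iter k S x) y <-> gap (n + k) x y.
Proof. by rewrite /gap iterD. Qed.

(** The common n steps cancel, and a weak inequality in a total order is the
    negation of the reverse strict one. *)
Lemma gap_iterr n k x y : (n <= k)%N -> gap n y (iter k S x) <-> ~ gap (k - n).+1 x y.
Proof.
move=> nk; rewrite /gap -{1}(subnKC nk) iterD le_iter /= leS.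
by split=> [h /(_ h)|/contrapT].
Qed.

Lemma gap_iterr' n k x y : (k <= n)%N -> gap n y (iter k S x) <-> gap (n - k) y x.
Proof. by move=> nk; rewrite -{1}(subnKC nk) /gap iterD le_iter. Qed.

Lemma gap_shift n k x y : gap n (iter k S x) (iter k S y) <-> gap n x y.
Proof. by rewrite gap_iterl gap_iterr' ?leq_addl // addnK. Qed.

Lemma le_S x : le x (S x).
Proof. by case: (le_tot x (S x)) => // /leS /(_ (le_r x)). Qed.

Lemma le_iter_self n x : le x (iter n S x).
Proof. by elim: n => //= n IH; apply: le_tr IH (le_S _). Qed.

Lemma gap_trans m n x y z : gap m x y -> gap n y z -> gap (m + n) x z.
Proof. by move=> xy; apply: le_tr; rewrite addnC iterD le_iter. Qed.

Lemma gap_le n x y m : gap n x y -> (m <= n)%N -> gap m x y.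
Proof.
move=> h mn; apply: le_tr h; rewrite -(subnK mn) iterD; exact: le_iter_self.
Qed.

Lemma gap_lt n x y : gap n.+1 x y -> ~ le y x.
Proof. by move=> h; apply/leS; exact: (gap_le h (m := 1)). Qed.

Lemma gap_eq n x x' y y' : le x x' -> le x' x -> le y y' -> le y' y ->
  gap n x y <-> gap n x' y'.
Proof.
move=> a b c d; split=> h; apply: (le_tr _ (le_tr h _)) => //; exact/le_iter.
Qed.

Lemma col_iter k x y : (col x <-> col y) -> (col (iter k S x) <-> col (iter k S y)).
Proof. by move=> h; elim: k => //= k IH; rewrite !colS IH. Qed.

Lemma gap_cases m x y : le x y -> ~ gap m x y ->
  exists k, [/\ (k < m)%N, le (iter k S x) y & le y (iter k S x)].
Proof.
move=> xy; elim: m => [//|m IH] ng.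
case: (pselect (gap m x y)) => [h|/IH[k [km ? ?]]]; last by exists k; split=> //; lia.
by exists m; split=> //; apply: contrapT => /leS.
Qed.

Lemma iter_pred k y : gap k o y -> exists x, le (iter k S x) y /\ le y (iter k S x).
Proof.
elim: k y => [|k IH] y h; first by exists y.
have [y1 [y1y yy1]] := pred_ex (gap_lt h).
have [x [xy yx]] : exists x, le (iter k S x) y1 /\ le y1 (iter k S x).
  by apply: IH; apply/le_S2; exact: le_tr h yy1.
by exists x; split=> /=; [apply: le_tr y1y|apply: le_tr yy1 _]; apply/le_S2.
Qed.

(** A pair in L consists of a point and its counterpart: L is the graph of a partial
    map that preserves colours and distances up to N. *)
Definition sim N (L : seq (I * I)) := forall p q, p \in L -> q \in L ->
  (forall n, (n <= N)%N -> gap n p.1 q.1 <-> gap n p.2 q.2) /\ (col p.1 <-> col p.2).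

Lemma sim_le N N' L : (N <= N')%N -> sim N' L -> sim N L.
Proof.
move=> h H p q pL qL; have [a b] := H p q pL qL.
by split=> // n nN; apply: a; lia.
Qed.

Lemma gap_self n x : gap n x x <-> n = 0%N.
Proof.
case: n => [|n]; split=> // h; first exact: le_r.
by case: (gap_lt h (le_r x)).
Qed.

Lemma sim_cons N L g g' : sim N L -> (col g <-> col g') ->
  (forall q n, q \in L -> (n <= N)%N -> gap n g q.1 <-> gap n g' q.2) ->
  (forall q n, q \in L -> (n <= N)%N -> gap n q.1 g <-> gap n q.2 g') ->
  sim N ((g, g') :: L).
Proof.
move=> sL cg h1 h2 p q; rewrite !in_cons => /orP[/eqP ->|pL] /orP[/eqP ->|qL] /=.
- by split=> // n _; rewrite !gap_self.
- by split=> // n nN; exact: h1.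
- by have [_ ?] := sL p p pL pL; split=> // n nN; exact: h2.
- exact: sL.
Qed.

(** The extension step of the game. If g is within N + 1 steps above a point of L or
    within N steps below one, its counterpart is at the same distance from the
    counterpart of that point. Otherwise let p be the last point of L below g. Then
    g is N + 2 or more steps above p and N + 1 or more below each later point of L,
    so p is at least 2 N + 3 steps before the later points and the same holds for
    the counterparts. Hence both the point N + 1 steps and the one N + 2 steps above
    the counterpart of p are out of reach of all counterparts; one of the two has
    the colour of g. *)
Lemma sim_extend N L : sim (2 * N + 3) L -> (o, o) \in L ->
  forall g, exists g', sim N ((g, g') :: L).
Proof.
move=> sL oL g.
have sNL : sim N L by apply: sim_le sL; lia.
have [[p [pL [k [kN pg gp]]]]|far1] := pselect (exists p, p \in L /\
    exists k, [/\ (k <= N.+1)%N, le (iter k S p.1) g & le g (iter k S p.1)]).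
  exists (iter k S p.2); apply: sim_cons => //.
  - rewrite -(col_le pg gp); apply: col_iter; exact: (sL p p pL pL).2.
  - move=> q n qL nN; rewrite -(gap_eq n pg gp (le_r q.1) (le_r q.1)) !gap_iterl.
    apply: (sL p q pL qL).1; lia.
  - move=> q n qL nN; rewrite -(gap_eq n (le_r q.1) (le_r q.1) pg gp).
    case: (leqP n k) => nk.
      have h : ((k - n).+1 <= 2 * N + 3)%N by lia.
      by rewrite !gap_iterr // ((sL p q pL qL).1 _ h).
    rewrite !gap_iterr' ?(ltnW nk) //; apply: (sL q p qL pL).1; lia.
(* The counterpart is reached by going back k steps, which is possible since p.2 is
   at least k steps after o, as p.1 is. *)
have [[p [pL [k [kN pg gp]]]]|far2] := pselect (exists p, p \in L /\
    exists k, [/\ (k <= N)%N, le (iter k S g) p.1 & le p.1 (iter k S g)]).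
  have k0 : gap k o p.2.
    apply: ((sL (o, o) p oL pL).1 k _).1; first by lia.
    by apply: le_tr pg; apply/le_iter.
  have [g' [g'p pg']] := iter_pred k0.
  exists g'; apply: sim_cons => //.
  - have := col_le pg gp; have := col_le g'p pg'; have := (sL p p pL pL).2 => e1 e2 e3.
    have {e1 e2 e3} : col (iter k S g) <-> col (iter k S g') by tauto.
    elim: (k) => //= j IH; rewrite !colS => h; apply: IH.
    by case: (pselect (col (iter j S g))) (pselect (col (iter j S g'))) => ? [] ?; tauto.
  - move=> q n qL nN; rewrite -(gap_shift n k g) -(gap_shift n k g').
    rewrite (gap_eq n pg gp (le_r _) (le_r _)) (gap_eq n g'p pg' (le_r _) (le_r _)).
    case: (leqP n k) => nk.
      have h : ((k - n).+1 <= 2 * N + 3)%N by lia.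
      by rewrite !gap_iterr // ((sL q p qL pL).1 _ h).
    rewrite !gap_iterr' ?(ltnW nk) //; apply: (sL p q pL qL).1; lia.
  - move=> q n qL nN; rewrite -(gap_shift n k q.1) -(gap_shift n k q.2).
    rewrite (gap_eq n (le_r _) (le_r _) pg gp) (gap_eq n (le_r _) (le_r _) g'p pg').
    rewrite !gap_iterl; apply: (sL q p qL pL).1; lia.
have [p [pL pg pmax]] := @seq_max _ (fun p q : I * I => le p.1 q.1) (fun p => le p.1 g)
  L (o, o) (fun _ _ => le_tot _ _) (fun _ _ _ => @le_tr _ _ _) oL (le_o g).
have farp q : q \in L -> le q.1 g -> gap N.+2 q.1 g.
  move=> qL qg; apply: contrapT => /(gap_cases qg)[k [kN a b]].
  by apply: far1; exists q; split=> //; exists k.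
have farq q : q \in L -> ~ le q.1 g -> gap N.+1 g q.1.
  move=> qL qg; apply: contrapT => h.
  have [] := gap_cases _ h; first by case: (le_tot g q.1).
  by move=> k [kN a b]; apply: far2; exists q; split=> //; exists k.
have [k [k1 k2 ck]] : exists k,
    [/\ (N.+1 <= k)%N, (k <= N.+2)%N & col g <-> col (iter k S p.2)].
  case: (pselect (col g <-> col (iter N.+1 S p.2))) => h.
    by exists N.+1; split=> //; lia.
  exists N.+2; split; try lia.
  rewrite [iter N.+2 _ _]iterS colS.
  by case: (pselect (col g)) (pselect (col (iter N.+1 S p.2))) => ? [] ?; tauto.
exists (iter k S p.2).
have lo q : q \in L -> le q.1 g -> le q.2 p.2.
  by move=> qL qg; apply: ((sL q p qL pL).1 0%N isT).1; exact: pmax.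
have hi q : q \in L -> ~ le q.1 g -> gap N.+1 (iter k S p.2) q.2.
  move=> qL qg; apply/gap_iterl.
  have h : gap (2 * N + 3) p.1 q.1.
    by apply: gap_le (gap_trans (farp p pL pg) (farq q qL qg)) _; lia.
  have := ((sL p q pL qL).1 _ (leqnn _)).1 h => /gap_le; apply; lia.
apply: sim_cons => // q n qL nN; case: (pselect (le q.1 g)) => qg.
- have nk : ~ le (iter k S p.2) q.2.
    move=> h; have g1 : gap 1 p.2 p.2.
      by apply: (gap_le (n := k)); [exact: le_tr h (lo q qL qg)|lia].
    exact: gap_lt g1 (le_r _).
  split=> h; last by case: nk; exact: (gap_le h (leq0n n)).
  by case: (gap_lt (farp q qL qg)); exact: (gap_le h (leq0n n)).
- by split=> _; [apply: gap_le (hi q qL qg) _|apply: gap_le (farq q qL qg) _]; lia.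
- split=> _; last by apply: gap_le (farp q qL qg) _; lia.
  by rewrite gap_iterr; [move=> h; apply: (gap_lt h); exact: lo|lia].
- split=> h; first by case: qg; exact: (gap_le h (leq0n n)).
  by case: (gap_lt (hi q qL qg)); exact: (gap_le h (leq0n n)).
Qed.

End DiscreteOrder.

(** * Models as ordered rational vector spaces *)

(** The axioms are a parameter, so that the algebraic structure which they provide
    can be attached to the carrier. *)
Definition vec (M : structure) (A : T_axioms M) : Type := carrier M.

Section VecInstances.
Variables (M : structure) (A : T_axioms M).
Local Notation V := (vec A).

HB.instance Definition _ := gen_eqMixin V.
HB.instance Definition _ := gen_choiceMixin V.

Definition vopp (x : V) : V := scaleI (-1) x.

Lemma vaddNr : left_inverse (zeroI : V) vopp (@addI M).
Proof.
move=> x; rewrite (ax_addC A).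
by apply/(ord_opp (ax_addA A) (ax_addC A) (ax_add0 A) (ax_opp A)
  (ax_scale1 A) (ax_scaleDl A)).
Qed.

HB.instance Definition _ := GRing.isZmodule.Build V
  (ax_addA A) (ax_addC A) (ax_add0 A) vaddNr.

Lemma vscaleDl (x : V) : {morph (fun q => scaleI q x : V) : q r / q + r}.
Proof. by move=> q r; exact: (ax_scaleDl A). Qed.

HB.instance Definition _ := GRing.Zmodule_isLmodule.Build rat V
  (ax_scaleA A) (ax_scale1 A) (ax_scaleDr A) vscaleDl.

Definition vlt (x y : V) : bool := `[< ltI x y >].

Lemma vlt_irr : irreflexive vlt.
Proof. by move=> x; apply/asboolP; exact: (ax_lt_irr A). Qed.

Lemma vlt_trans : transitive vlt.
Proof.
by move=> y x z /asboolP xy /asboolP yz; apply/asboolP; exact: (ax_lt_trans A) xy yz.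
Qed.

Lemma vlt_total (x y : V) : x != y -> vlt x y || vlt y x.
Proof.
move=> /eqP xy; apply/orP; have [h|//|h] := ax_lt_total A x y.
  by left; apply/asboolP.
by right; apply/asboolP.
Qed.

HB.instance Definition _ := Order.LtOrder.Build ring_display V
  (fun _ _ => erefl) (fun _ _ => erefl) (fun _ _ => erefl)
  vlt_irr vlt_trans vlt_total.

End VecInstances.

(** * The valuation by components *)

Section Valuation.
Variables (M : structure) (A : T_axioms M).
Local Notation V := (vec A).
Implicit Types x y z u w : V.

Definition inP x : Prop := PI (x : M).

Lemma vltP x y : reflect (ltI (x : M) y) (x < y).
Proof. exact: asboolP. Qed.

Lemma vleP x y : (x <= y) <-> leI (x : M) y.
Proof.
rewrite le_eqVlt; split=> [/orP[/eqP ->|/vltP]|[/vltP ->|->]].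
- by right.
- by left.
- by rewrite orbT.
- by rewrite eqxx.
Qed.

Lemma vltD2r z x y : (x + z < y + z) = (x < y).
Proof.
have D (a b c : V) : a < b -> a + c < b + c.
  by move=> /vltP h; apply/vltP; exact: (ax_lt_add A).
by apply/idP/idP => [/(D _ _ (- z))|/D //]; rewrite !addrK.
Qed.

Lemma vleD2r z x y : (x + z <= y + z) = (x <= y).
Proof. by rewrite !leNgt vltD2r. Qed.

Lemma vsub_gt0 x y : (0 < y - x) = (x < y).
Proof. by rewrite -(vltD2r x 0) subrK add0r. Qed.

Lemma vsub_lt0 x y : (y - x < 0) = (y < x).
Proof. by rewrite -(vltD2r x (y - x)) subrK add0r. Qed.

Lemma voppr_gt0 x : (0 < - x) = (x < 0).
Proof. by rewrite -(vltD2r x 0) add0r addNr. Qed.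

Lemma voppr_lt0 x : (- x < 0) = (0 < x).
Proof. by rewrite -(vltD2r x (- x)) add0r addNr. Qed.

Lemma voppr_ge0 x : (0 <= - x) = (x <= 0).
Proof. by rewrite !leNgt voppr_lt0. Qed.

Lemma vltN2 x y : (- x < - y) = (y < x).
Proof. by rewrite -[LHS]vsub_gt0 opprK addrC vsub_gt0. Qed.

Lemma vleD a b c d : (a : V) <= b -> (c : V) <= d -> a + c <= b + d.
Proof.
move=> ab cd; apply: (@le_trans _ _ (b + c)); first by rewrite vleD2r.
by rewrite ![b + _]addrC vleD2r.
Qed.

Lemma vaddr_ge0 x y : 0 <= x -> 0 <= y -> 0 <= x + y.
Proof. by move=> hx hy; rewrite -[0]addr0; exact: vleD. Qed.

Lemma vaddr_gt0 x y : 0 < x -> 0 <= y -> 0 < x + y.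
Proof.
move=> hx hy; apply: lt_le_trans hx _.
by rewrite -{1}[x]addr0; exact: vleD.
Qed.

Lemma vscalen_ge0 (n : nat) x : 0 <= x -> 0 <= n%:R *: x.
Proof.
move=> x0; elim: n => [|n IH]; first by rewrite scale0r.
by rewrite -natr1 scalerDl scale1r; exact: vaddr_ge0.
Qed.

Lemma vscale_ge0 (q : rat) x : 0 <= q -> 0 <= x -> 0 <= q *: x.
Proof.
move=> q0 x0; rewrite leNgt; apply/negP => neg.
have e2 : `|denq q|%N%:R *: (q *: x) = `|numq q|%N%:R *: x.
  have nat_abs (z : int) : 0 <= z -> (`|z|%N%:R : rat) = z%:~R.
    by move=> z0; rewrite -{2}(gez0_abs z0).
  by rewrite scalerA !nat_abs ?numq_ge0 // mulrC -numqE.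
have: 0 <= `|numq q|%N%:R *: x by exact: vscalen_ge0.
rewrite -e2; case E : `|denq q|%N => [|n].
  by move: E => /eqP; rewrite absz_eq0 (negPf (denq_neq0 q)).
rewrite leNgt => /negP; apply.
rewrite -voppr_gt0 -scalerN -natr1 scalerDl scale1r addrC.
apply: vaddr_gt0; first by rewrite voppr_gt0.
by apply: vscalen_ge0; rewrite voppr_ge0 ltW.
Qed.

Lemma vscale_gt0 (q : rat) x : 0 < q -> 0 < x -> 0 < q *: x.
Proof.
move=> q0 x0; rewrite lt_def vscale_ge0 ?ltW // andbT scaler_eq0.
by rewrite negb_or !gt_eqF.
Qed.

Definition vabs x : V := if 0 <= x then x else - x.

Lemma vabs_id x : 0 <= x -> vabs x = x. Proof. by rewrite /vabs => ->. Qed.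

Lemma vabs_le0 x : x <= 0 -> vabs x = - x.
Proof. by rewrite /vabs; case: (ltgtP x 0) => // ->; rewrite oppr0. Qed.

Lemma vabs_ge0 x : 0 <= vabs x.
Proof. by rewrite /vabs; case: (leP (0 : V) x) => // /ltW; rewrite voppr_ge0. Qed.

Lemma vabsN x : vabs (- x) = vabs x.
Proof.
case: (leP (0 : V) x) => h; last first.
  by rewrite vabs_id ?voppr_ge0 ?(ltW h) // vabs_le0 // ltW.
by rewrite (vabs_id h) vabs_le0 ?opprK // -[_ <= 0]voppr_ge0 opprK.
Qed.

Lemma le_vabs x : x <= vabs x.
Proof.
rewrite /vabs; case: (leP (0 : V) x) => // h.
by rewrite (le_trans (ltW h)) // voppr_ge0 ltW.
Qed.

Lemma vabs_add x y : vabs (x + y) <= vabs x + vabs y.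
Proof.
rewrite {1}/vabs; case: ifP => _; first by apply: vleD; exact: le_vabs.
by rewrite opprD -(vabsN x) -(vabsN y); apply: vleD; exact: le_vabs.
Qed.

Lemma inPN x : inP (- x) <-> inP x.
Proof.
apply: iff_sym; apply: (ax_Popp A).
exact: (subrr (x : V)).
Qed.

Lemma inP_abs x : inP (vabs x) <-> inP x.
Proof. by rewrite /vabs; case: ifP => // _; exact: inPN. Qed.

Lemma inP0 : inP 0. Proof. exact: ax_P0. Qed.

(** The component of |x| is not above that of |y|: if |y| < |x|, then the interval
    between them is contained in P or in its complement. If |x| <= |y| only
    u = |y| can satisfy the bounds. *)
Definition val_le x y : Prop :=
  forall u, vabs y <= u -> u <= vabs x -> (inP u <-> inP y).

Lemma val_le_abs x y : vabs x <= vabs y -> val_le x y.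
Proof.
move=> xy u yu ux; rewrite -(inP_abs y).
by have -> : u = vabs y by apply: le_anti; rewrite yu (le_trans ux xy).
Qed.

Lemma val_lexx x : val_le x x. Proof. exact: val_le_abs. Qed.

Lemma val_le_total x y : val_le x y \/ val_le y x.
Proof. by case: (leP (vabs x) (vabs y)) => [|/ltW] /val_le_abs; [left|right]. Qed.

Lemma nval_le_abs x y : ~ val_le y x -> vabs x < vabs y.
Proof. by move=> n; rewrite ltNge; apply/negP => /val_le_abs. Qed.

Lemma val_le_trans y x z : val_le x y -> val_le y z -> val_le x z.
Proof.
move=> xy yz u zu ux.
case: (leP u (vabs y)) => uy; first exact: yz.
case: (leP (vabs z) (vabs y)) => zy.
  rewrite (xy u) ?(ltW uy) // -(inP_abs y); exact: yz.
rewrite (xy u) ?(ltW uy) // -(inP_abs z); apply: iff_sym; apply: xy; first exact: ltW.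
exact: le_trans zu ux.
Qed.

Definition val_eq x y : Prop := val_le x y /\ val_le y x.

Lemma val_eq_refl x : val_eq x x. Proof. by split; exact: val_lexx. Qed.
Lemma val_eq_sym x y : val_eq x y -> val_eq y x. Proof. by case. Qed.
Lemma val_eq_trans y x z : val_eq x y -> val_eq y z -> val_eq x z.
Proof.
by move=> [a b] [c d]; split; [exact: val_le_trans a c|exact: val_le_trans d b].
Qed.
Lemma nval_le x y : ~ val_le x y -> val_le y x.
Proof. by case: (val_le_total x y). Qed.

Lemma val_eq_P x y : val_eq x y -> (inP x <-> inP y).
Proof.
wlog xy : x y / vabs x <= vabs y => [H e|[_ h]].
  case: (leP (vabs x) (vabs y)) => [/H|/ltW/H K]; first exact.
  by apply: iff_sym; apply: K; exact: val_eq_sym.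
by rewrite -(inP_abs y); apply: iff_sym; apply: h.
Qed.

Lemma val_le0 x : val_le 0 x.
Proof. by apply: val_le_abs; rewrite vabs_id //; exact: vabs_ge0. Qed.

Lemma val_eqN x : val_eq (- x) x.
Proof. by split; apply: val_le_abs; rewrite vabsN. Qed.

Lemma val_eq_abs x : val_eq (vabs x) x.
Proof. by rewrite /vabs; case: ifP => _; [exact: val_eq_refl|exact: val_eqN]. Qed.

Lemma colorI_P c x : colorI c (x : M) <-> (inP x <-> c).
Proof. exact: colorIP. Qed.

(** This is ax_comp at the pair x, x, with q x = (q/2) x + (q/2) x. *)
Lemma val_eq_pscale (q : rat) x : 0 < q -> 0 <= x -> val_eq (q *: x) x.
Proof.
move=> q0 x0.
have q2 : 0 < q / 2%:R by rewrite divr_gt0.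
have key := ax_comp A.
have ltT := ax_lt_trans A; have tot := ax_lt_total A.
have [c cx] : exists c, colorI c (x : M).
  by case: (pselect (inP x)) => h; [exists true|exists false].
have xx : leI (x : M) x by right.
have sub : (@cc_interval M x x `<=` colorI c)%classic.
  move=> w [/vleP xw /vleP wx].
  by have -> : (w : V) = x by apply: le_anti; rewrite xw wx.
have [/(same_componentP _ _ _ ltT tot) [h1 h2] _] := key c _ _ q2 q2 x x xx sub.
have e : (addI (scaleI (q / 2%:R) (x:M)) (scaleI (q / 2%:R) (x:M))) = q *: x.
  rewrite -[LHS]/((q / 2%:R) *: x + (q / 2%:R) *: x) -scalerDl.
  by rewrite -mulrDr (_ : 2%:R^-1 + 2%:R^-1 = 1) ?mulr1.
rewrite e in h1 h2.
have qx0 := vscale_ge0 (ltW q0) x0.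
have cM u : colorI c (u : M) -> (inP u <-> inP x).
  by move=> /colorI_P ->; apply: iff_sym; apply/colorI_P.
have cqx : inP (q *: x) <-> inP x.
  case: (leP (q *: x) x) => h; apply: cM.
    by apply: h1; split; [right|apply/vleP].
  by apply: h2; split; [apply/vleP; exact: ltW|right].
split=> u; rewrite !vabs_id // => a b.
  by apply: cM; apply: h2; split; apply/vleP.
by rewrite cqx; apply: cM; apply: h1; split; apply/vleP.
Qed.

Lemma val_eq_scale (q : rat) x : q != 0 -> val_eq (q *: x) x.
Proof.
have H (r : rat) y : 0 < r -> val_eq (r *: y) y.
  move=> r0; case: (leP (0 : V) y) => h; first exact: val_eq_pscale.
  apply: val_eq_trans (val_eqN y).
  apply: val_eq_trans (val_eq_pscale r0 (_ : 0 <= - y)).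
    by rewrite scalerN; apply: val_eq_sym; exact: val_eqN.
  by rewrite voppr_ge0 ltW.
rewrite neq_lt => /orP[q0|]; last exact: H.
rewrite -[q]opprK scaleNr; apply: val_eq_trans (val_eqN _) _.
by apply: H; rewrite oppr_gt0.
Qed.

(** If |x| <= |y| then |x + y| <= 2 |y|, and 2 |y| has the valuation of y. *)
Lemma val_le_add x y m : val_le x m -> val_le y m -> val_le (x + y) m.
Proof.
move=> xm ym; wlog xy : x y xm ym / vabs x <= vabs y => [H|].
  by case: (leP (vabs x) (vabs y)) => [|/ltW] h; [|rewrite addrC]; exact: H.
apply: val_le_trans ym; apply: val_le_trans (val_eq_abs y).1.
apply: val_le_trans (val_eq_scale (vabs y) (_ : 2%:R != 0)).1 => //.
apply: val_le_abs; rewrite (le_trans (vabs_add _ _)) // scaler_nat mulr2n.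
rewrite [vabs (_ + _)]vabs_id; first by apply: vleD.
by apply: vaddr_ge0; exact: vabs_ge0.
Qed.

Lemma val_eq_addl x y : ~ val_le x y -> val_eq (x + y) x.
Proof.
move=> n; have h := nval_le n.
split; first by apply: val_le_add => //; exact: val_lexx.
apply: contrapT => m; apply: n.
have: val_le ((x + y) - y) y.
  have [k|k] := val_le_total (x + y) y.
    by apply: val_le_add => //; exact: (val_eqN y).1.
  case: m; rewrite -{1}(addrK y x).
  by apply: val_le_add; [exact: val_lexx|exact: val_le_trans (val_eqN y).1 k].
by rewrite addrK.
Qed.

(** ** Successors and predecessors of values *)

Definition is_succ x y : Prop := forall z, val_le y z <-> ~ val_le z x.

Lemma two_colors (a b c : Prop) : ~ (a <-> c) -> ~ (b <-> c) -> (a <-> b).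
Proof. by case: (pselect a) (pselect b) (pselect c) => ha [] hb [] hc; tauto. Qed.

(** The colour changes exactly once on [x, y]. A value above that of x comes with
    some u beyond x of the other colour, and from u on the colour is constant up to
    y; so the value of y is not above it. *)
Lemma is_succ_core x y : 0 <= x -> x < y -> (inP y <-> ~ inP x) ->
  (forall u w, x < u -> u < w -> w <= y -> ~ (inP u <-> inP x) -> ~ (inP w <-> inP x)) ->
  is_succ x y.
Proof.
move=> x0 xy yx alt z.
have y0 : 0 <= y by rewrite (le_trans x0) // ltW.
split=> [yz zx|n].
  have := val_le_trans yz zx (u := y); rewrite !vabs_id // => /(_ (ltW xy) (lexx _)) h.
  by tauto.
have [u [xu uz Pu]] : exists u, [/\ x <= u, u <= vabs z & ~ (inP u <-> inP x)].
  apply: contrapT => nex; apply: n => u; rewrite (vabs_id x0) => xu uz.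
  by apply: contrapT => Pu; apply: nex; exists u.
have xu' : x < u by rewrite lt_def xu andbT; apply/eqP => e; apply: Pu; rewrite e.
have col w : u <= w -> w <= y -> ~ (inP w <-> inP x).
  rewrite le_eqVlt => /orP[/eqP <- //|uw] wy; exact: alt xu' uw wy Pu.
move=> w zw; rewrite (vabs_id y0) => wy.
have h1 := col w (le_trans uz zw) wy.
have := col (vabs z) uz (le_trans zw wy); rewrite inP_abs => h2.
exact: two_colors h1 h2.
Qed.

Lemma RI1P x y : RI 1 (x : M) y -> [/\ x < y, inP y <-> ~ inP x &
  forall u w, x < u -> u < w -> w <= y -> ~ (inP u <-> inP x) -> ~ (inP w <-> inP x)].
Proof.
move=> /(ax_R A (isT : (0 < 1)%N) x y) [/vltP xy H].
suff [c [/colorIP cx [s [[s0 _ sc] s1]] nos]] : exists c, alternations c 1 (x : M) y.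
  split=> //.
    rewrite /inP; have := sc 1%N isT; rewrite s1 /= => ->; rewrite cx.
    by case: (c); split.
  move=> u w xu uw wy Pu Pw; apply: nos.
  exists (fun i => if i is j.+1 then if j is _.+1 then w else u else x).
  split; last exact/vleP.
  split=> //; first by move=> [|[|i]] // _; apply/vltP.
  move=> [|[|[|i]]] // _ /=; move: Pu Pw cx; rewrite ?addbF // ?addbT.
    move=> n _ xc; split=> [pu|/negP nc].
      by apply/negP => cc; apply: n; split=> // _; apply/xc.
    by apply: contrapT => npu; apply: n; split=> // /xc.
  by move=> _ [h1 h2] [h3 h4]; split=> [/h1/h3|/h4/h2].
by case: H; [exists true|exists false].
Qed.

(** P is open at 0, so the component of 0 has positive elements. The axioms on
    R_1 speak of positive elements only, and this lets them apply to the value of 0. *)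
Lemma ex_pos_val0 : exists2 e : V, 0 < e & val_eq e 0.
Proof.
have c0 : colorI true (0 : V) by exact: inP0.
have nend := no_endpoints (ax_addC A) (ax_add0 A) (ax_opp A) (ax_nontrivial A)
  (ax_lt_total A) (ax_lt_add A) (0 : V).
have [l [h [[/vltP l0 /vltP h0] sub]]] := oo_interval_bounded (ax_lt_trans A)
  (ax_lt_total A) nend.1 nend.2 (ax_open A c0).
pose e : V := 2%:R^-1 *: (h : V).
have e0 : 0 < e by apply: vscale_gt0.
have eh : e < h.
  rewrite -vsub_gt0 -{1}(scale1r (h : V)) -scalerBl; exact: vscale_gt0.
exists e => //; split; last exact: val_le0.
move=> u; rewrite !vabs_id ?(ltW e0) // => u0 ue.
have Pu : inP u.
  apply: (sub u); split; apply/vltP; first exact: lt_le_trans l0 u0.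
  exact: le_lt_trans ue eh.
by split=> // _; exact: inP0.
Qed.

Lemma ex_pos_repr x : exists2 y : V, 0 < y & val_eq y x.
Proof.
have [->|xn0] := eqVneq x 0; first by have [e e0 ev] := ex_pos_val0; exists e.
exists (vabs x); last exact: val_eq_abs.
rewrite lt_def vabs_ge0 andbT /vabs; case: ifP => //; by rewrite oppr_eq0.
Qed.

Lemma is_succ_val_eq x x' y y' :
  val_eq x x' -> val_eq y y' -> is_succ x y -> is_succ x' y'.
Proof.
move=> [xx' x'x] [yy' y'y] Sxy z; split=> [h k|h].
  by apply: (Sxy z).1; [exact: val_le_trans yy' h|exact: val_le_trans k x'x].
by apply: val_le_trans y'y _; apply/Sxy => k; apply: h; exact: val_le_trans k xx'.
Qed.

Lemma ex_succ x : exists y, is_succ x y /\ (inP y <-> ~ inP x).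
Proof.
have [x' x'0 e] := ex_pos_repr x.
have [y /RI1P[xy Py alt]] := ax_R1_above A ((vltP _ _) x'0).
exists y; rewrite -(val_eq_P e); split=> //.
apply: is_succ_val_eq e (val_eq_refl y) _; exact: is_succ_core (ltW x'0) xy Py alt.
Qed.

(** The axiom ax_R1_below gives some y before |x| with a single change of colour in between. If
    y is negative, that change must take place between 0 and |x|, for the colour
    does change there; then the value of 0 precedes that of x. *)
Lemma ex_pred x : ~ val_le x 0 -> exists y, is_succ y x.
Proof.
move=> n.
have e : val_eq (vabs x) x := val_eq_abs x.
have x0 : 0 < vabs x.
  rewrite lt_def vabs_ge0 andbT; apply/eqP => h; apply: n; rewrite -h; exact: e.2.
have [y /RI1P[yx Py alt]] := ax_R1_below A ((vltP _ _) x0).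
suff [p Sp] : exists p, is_succ p (vabs x).
  by exists p; exact: is_succ_val_eq (val_eq_refl p) e Sp.
case: (leP (0 : V) y) => y0; first by exists y; exact: is_succ_core.
exists 0.
have [u [u0 ux Pu]] : exists u, [/\ 0 < u, u <= vabs x & ~ inP u].
  apply: contrapT => nex; apply: n => u; rewrite (vabs_id (lexx _)) => u0 ux.
  have P00 := inP0; suff: inP u by tauto.
  move: u0; rewrite le_eqVlt => /orP[/eqP <- //|u0].
  by apply: contrapT => Pu; apply: nex; exists u.
have P00 := inP0.
have Pyy : inP y.
  apply: contrapT => nP; apply: (alt 0 u) => //; tauto.
apply: is_succ_core => //; first by tauto.
move=> v w v0 vw wx h1 h2; apply: (alt v w) => //; last by tauto.
  exact: lt_trans y0 v0.
by tauto.
Qed.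

Definition vsucc x : V := projT1 (cid (ex_succ x)).

Lemma vsuccP x y : val_le (vsucc x) y <-> ~ val_le y x.
Proof. by rewrite /vsucc; case: cid => s [h _] /=. Qed.

Lemma inP_succ x : inP (vsucc x) <-> ~ inP x.
Proof. by rewrite /vsucc; case: cid => s [_ h] /=. Qed.

Lemma val_eq_pred x : ~ val_le x 0 -> exists y, val_eq (vsucc y) x.
Proof.
move=> /ex_pred[y yx]; exists y.
split; first by apply: (vsuccP _ _).2; apply: (yx _).1; exact: val_lexx.
by apply: (yx _).2; apply: (vsuccP _ _).1; exact: val_lexx.
Qed.

End Valuation.

(** * Extending a similarity by one point *)

Section Game.
Variables (M : structure) (A : T_axioms M).
Local Notation V := (vec A).
Implicit Types (x y z c d g : V) (p q : V * V).

Definition vsim : nat -> seq (V * V) -> Prop :=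
  sim (@val_le M A) (@vsucc M A) (@inP M A).

Lemma vsim_extend N (L : seq (V * V)) : vsim (2 * N + 3) L -> (0, 0) \in L ->
  forall g, exists g', vsim N ((g, g') :: L).
Proof.
apply: sim_extend.
- exact: val_le_total.
- by move=> x y z; exact: val_le_trans.
- exact: vsuccP.
- exact: val_le0.
- by move=> x /val_eq_pred[y [? ?]]; exists y.
- exact: inP_succ.
- by move=> x y xy yx; exact: val_eq_P.
Qed.

Lemma vsim_val_le N (L : seq (V * V)) p q : vsim N L -> p \in L -> q \in L ->
  (val_le p.1 q.1 <-> val_le p.2 q.2).
Proof. by move=> sL pL qL; exact: (sL p q pL qL).1 0%N isT. Qed.

Definition same_sign x y : Prop := (0 < x) = (0 < y) /\ (x < 0) = (y < 0).

Lemma same_sign_sym x y : same_sign x y -> same_sign y x. Proof. by case. Qed.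
Lemma same_sign_trans y x z : same_sign x y -> same_sign y z -> same_sign x z.
Proof. by move=> [a b] [c d]; rewrite /same_sign a b c d. Qed.

Lemma same_sign_pos x y : 0 < x -> 0 < y -> same_sign x y.
Proof. by move=> x0 y0; rewrite /same_sign x0 y0 (lt_gtF x0) (lt_gtF y0). Qed.

Lemma same_signN x y : same_sign (- x) (- y) <-> same_sign x y.
Proof. by rewrite /same_sign !voppr_gt0 !voppr_lt0; split=> -[]. Qed.

Lemma same_sign_ge0 x y : same_sign x y -> 0 <= x -> 0 <= y.
Proof. by move=> [_ e]; rewrite !leNgt e. Qed.

Lemma same_sign_scale (r : rat) x y : same_sign x y -> same_sign (r *: x) (r *: y).
Proof.
have H (s : rat) x' y' : 0 < s -> same_sign x' y' -> same_sign (s *: x') (s *: y').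
  move=> s0; case: (ltgtP x' 0) => [h|h|->] [].
  - rewrite h => _ /esym h'.
    by apply/same_signN; rewrite -!scalerN; apply: same_sign_pos; apply: vscale_gt0;
      rewrite ?voppr_gt0.
  - rewrite h => /esym h' _; apply: same_sign_pos; exact: vscale_gt0.
  - rewrite ltxx; case: (ltgtP y' 0) => // -> _ _; by rewrite !scaler0.
have [r0|r0|->] := ltgtP r 0; last by rewrite !scale0r.
  by move=> h; apply/same_signN; rewrite -!scaleNr; apply: H => //; rewrite oppr_gt0.
exact: H.
Qed.

(** The summand of larger valuation is larger in absolute value. *)
Lemma same_sign_dom x y : ~ val_le x y -> same_sign (x + y) x.
Proof.
have H x' y' : 0 < x' -> ~ val_le x' y' -> 0 < x' + y'.
  move=> x0 n; have : vabs y' < vabs x' by apply: nval_le_abs.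
  rewrite (vabs_id (ltW x0)) => h; rewrite -[y']opprK vsub_gt0.
  by apply: le_lt_trans h; rewrite -vabsN; exact: le_vabs.
move=> n; have [h|h|h] := ltgtP x 0.
- apply/same_signN; rewrite opprD; apply: same_sign_pos; rewrite ?voppr_gt0 //.
  apply: H; rewrite ?voppr_gt0 // => k; apply: n.
  apply: val_le_trans (val_eqN x).2 (val_le_trans k (val_eqN y).1).
- by apply: same_sign_pos => //; exact: H.
- by case: n; rewrite h; exact: val_le0.
Qed.

(** Without cancellation the valuation of a sum is the larger one. *)
Lemma val_eq_pos_add x y g :
  0 <= x -> 0 <= y -> val_eq x g -> val_le y g -> val_eq (x + y) g.
Proof.
move=> x0 y0 [xg gx] yg; split; first exact: val_le_add.
apply: val_le_trans gx (val_le_abs _); rewrite !vabs_id ?vaddr_ge0 //.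
by rewrite -{1}[x]addr0; exact: vleD.
Qed.

Lemma vsub_chain y x z : x - z = (x - y) + (y - z).
Proof. by rewrite addrA subrK. Qed.

Lemma vsub_chainC y x z : x - z = (y - z) + (x - y).
Proof. by rewrite [RHS]addrC -vsub_chain. Qed.

(** The pairs in C are the points from which the distance of the new point c
    matters, with their counterparts. If c is one of these points, d is its
    counterpart. Otherwise let g be c minus the nearest of them, j, in
    the sense of the valuation. If p in C is further from c than j is, then j - p
    dominates g, so c - p inherits sign and valuation from j - p, which is in L. The
    other p all satisfy that c - p has the valuation of g. For these it suffices to
    place d in the same gap between the counterparts, at the distance g' provided by
    the game on values: half way between the two neighbours if there is one on each
    side, since their difference then has the valuation of g, and otherwise at a
    point of valuation g' beyond the only neighbour. *)
Lemma extend_point N (L C : seq (V * V)) : vsim (2 * N + 3) L -> (0, 0) \in L ->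
  (forall p q, p \in C -> q \in C -> (p.1 - q.1, p.2 - q.2) \in L) ->
  (forall p, p \in L -> same_sign p.1 p.2) ->
  forall c, exists d g g', vsim N ((g, g') :: L) /\ forall p, p \in C ->
    same_sign (c - p.1) (d - p.2) /\
    exists w, [/\ w \in (g, g') :: L, val_eq (c - p.1) w.1 & val_eq (d - p.2) w.2].
Proof.
move=> sL oL CL sgL c.
have sL0 : vsim N ((0, 0) :: L).
  have sNL : vsim N L by apply: sim_le sL; lia.
  by move=> p q; rewrite !in_cons => /orP[/eqP ->|pL] /orP[/eqP ->|qL]; exact: sNL.
have [[p pC cp]|cC] := pselect (exists2 p, p \in C & c = p.1).
  exists p.2, 0, 0; split=> // q qC; rewrite cp; have w := CL p q pC qC.
  split; first exact: (sgL _ w).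
  by exists (p.1 - q.1, p.2 - q.2); rewrite in_cons w orbT; split=> //; exact: val_eq_refl.
have [[j0 j0C]|C0] := pselect (exists p, p \in C); last first.
  by exists 0, 0, 0; split=> // q qC; case: C0; exists q.
have [j [jC _ jmin]] := @seq_max _ (fun p q => val_le (c - q.1) (c - p.1)) (fun=> True)
  C j0 (fun _ _ => val_le_total _ _) (fun _ _ _ a b => val_le_trans b a) j0C I.
pose g := c - j.1; have [g' sg'] := vsim_extend sL oL g.
have inL p : p \in L -> p \in (g, g') :: L by rewrite in_cons orbC => ->.
have gL : (g, g') \in (g, g') :: L by rewrite mem_head.
pose G p := val_le (c - p.1) g.
have Gg p : p \in C -> G p -> val_eq (c - p.1) g.
  by move=> pC Gp; split=> //; exact: jmin.
suff [d Hd] : exists d, forall p, p \in C -> G p ->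
    same_sign (c - p.1) (d - p.2) /\ val_eq (d - p.2) g'.
  exists d, g, g'; split=> // p pC; case: (pselect (G p)) => Gp.
    have [h1 h2] := Hd p pC Gp; split=> //.
    by exists (g, g'); split=> //; exact: Gg.
  have w := CL j p jC pC.
  have [_ dj] := Hd j jC (@val_lexx M A g).
  have e1 : c - p.1 = (j.1 - p.1) + g by apply: vsub_chainC.
  have e2 : d - p.2 = (j.2 - p.2) + (d - j.2) by apply: vsub_chainC.
  have n1 : ~ val_le (j.1 - p.1) g.
    by move=> h; apply: Gp; rewrite /G e1; apply: val_le_add => //; exact: val_lexx.
  have n2 : ~ val_le (j.2 - p.2) (d - j.2).
    move=> h; apply: n1; apply/(vsim_val_le sg' (inL _ w) gL).
    exact: val_le_trans h dj.1.
  split.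
    rewrite e1 e2; apply: same_sign_trans (same_sign_dom n1) _.
    by apply: same_sign_trans (same_sign_sym (same_sign_dom n2)); exact: sgL _ w.
  exists (j.1 - p.1, j.2 - p.2); split; first exact: inL.
    by rewrite e1; exact: val_eq_addl.
  by rewrite e2; exact: val_eq_addl.
have Gdiff p q : p \in C -> q \in C -> G p -> G q -> val_le (p.2 - q.2) g'.
  move=> pC qC Gp Gq; apply/(vsim_val_le sg' (inL _ (CL p q pC qC)) gL) => /=.
  have -> : p.1 - q.1 = (c - q.1) + - (c - p.1) by rewrite opprB; apply: vsub_chainC.
  by apply: val_le_add => //; exact: val_le_trans (val_eqN _).1 Gp.
have pos p q : p \in C -> q \in C -> q.1 <= p.1 -> 0 <= p.2 - q.2.
  move=> pC qC qp; apply: (same_sign_ge0 (sgL _ (CL p q pC qC))) => /=.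
  by rewrite -(subrr q.1) vleD2r.
pose lo p := G p /\ p.1 < c; pose up p := G p /\ c < p.1.
have loup p : p \in C -> G p -> lo p \/ up p.
  move=> pC Gp; have [h|h|h] := ltgtP c p.1; [by right|by left|by case: cC; exists p].
pose below d := forall p, p \in C -> lo p -> 0 < d - p.2 /\ val_eq (d - p.2) g'.
pose above d := forall p, p \in C -> up p -> 0 < p.2 - d /\ val_eq (p.2 - d) g'.
suff [d [bd ad]] : exists d, below d /\ above d.
  exists d => p pC Gp; case: (loup p pC Gp) => h.
    have [h1 h2] := bd p pC h; split=> //.
    by apply: same_sign_pos; rewrite // vsub_gt0 h.2.
  have [h1 h2] := ad p pC h; split.
    by apply/same_signN; rewrite !opprB; apply: same_sign_pos; rewrite // vsub_gt0 h.2.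
  by rewrite -opprB; apply: val_eq_trans (val_eqN _) h2.
have belowP l d : l \in C -> lo l -> (forall q, q \in C -> lo q -> q.1 <= l.1) ->
    0 < d - l.2 -> val_eq (d - l.2) g' -> below d.
  move=> lC lol lmax d0 dg p pC lop.
  have -> : d - p.2 = (d - l.2) + (l.2 - p.2) by apply: vsub_chain.
  have h := pos l p lC pC (lmax p pC lop).
  split; first exact: vaddr_gt0.
  by apply: val_eq_pos_add => //; [exact: ltW|exact: Gdiff lC pC lol.1 lop.1].
have aboveP u d : u \in C -> up u -> (forall q, q \in C -> up q -> u.1 <= q.1) ->
    0 < u.2 - d -> val_eq (u.2 - d) g' -> above d.
  move=> uC upu umin d0 dg p pC upp.
  have -> : p.2 - d = (u.2 - d) + (p.2 - u.2) by apply: vsub_chainC.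
  have h := pos p u pC uC (umin p pC upp).
  split; first exact: vaddr_gt0.
  by apply: val_eq_pos_add => //; [exact: ltW|exact: Gdiff pC uC upp.1 upu.1].
have maxlo l0 : l0 \in C -> lo l0 ->
    exists l, [/\ l \in C, lo l & forall q, q \in C -> lo q -> q.1 <= l.1].
  move=> l0C lol0; apply: (@seq_max _ (fun p q => p.1 <= q.1) lo C l0) => //.
    by move=> x y; apply/orP; exact: le_total.
  by move=> x y z; exact: le_trans.
have minup u0 : u0 \in C -> up u0 ->
    exists u, [/\ u \in C, up u & forall q, q \in C -> up q -> u.1 <= q.1].
  move=> u0C upu0; apply: (@seq_max _ (fun p q => q.1 <= p.1) up C u0) => //.
    by move=> x y; apply/orP; exact: le_total.
  by move=> x y z /[swap]; exact: le_trans.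
have [e e0 eg] := ex_pos_repr g'.
have [[l0 [l0C lol0]]|nlo] := pselect (exists l, l \in C /\ lo l); last first.
  have [|u [uC upu umin]] := minup j jC.
    by case: (loup j jC (@val_lexx M A g)) => // h; case: nlo; exists j.
  exists (u.2 - e); split; first by move=> p pC lop; case: nlo; exists p.
  by apply: (aboveP u) => //; rewrite opprB addrC subrK.
have [l [lC lol lmax]] := maxlo l0 l0C lol0.
have [[u0 [u0C upu0]]|nup] := pselect (exists u, u \in C /\ up u); last first.
  exists (l.2 + e); split; last by move=> p pC upp; case: nup; exists p.
  by apply: (belowP l) => //; rewrite addrC addKr.
have [u [uC upu umin]] := minup u0 u0C upu0.
have w := CL u l uC lC.
have wg : val_eq (u.1 - l.1) g.
  have -> : u.1 - l.1 = (c - l.1) + (u.1 - c) by apply: vsub_chainC.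
  apply: val_eq_pos_add.
  - by rewrite ltW // vsub_gt0 lol.2.
  - by rewrite ltW // vsub_gt0 upu.2.
  - exact: Gg lC lol.1.
  - by rewrite -opprB; exact: val_le_trans (val_eqN _).1 upu.1.
have wg' : val_eq (u.2 - l.2) g'.
  by split; [apply/(vsim_val_le sg' (inL _ w) gL); exact: wg.1|
             apply/(vsim_val_le sg' gL (inL _ w)); exact: wg.2].
have w0 : 0 < u.2 - l.2.
  have [<- _] := sgL _ w; rewrite vsub_gt0; exact: lt_trans lol.2 upu.2.
pose h : V := 2%:R^-1 *: (u.2 - l.2).
have h0 : 0 < h by exact: vscale_gt0.
have hg : val_eq h g' by apply: val_eq_trans wg'; exact: val_eq_scale.
have dh : u.2 - (l.2 + h) = h.
  rewrite opprD addrA -{1}(scale1r (u.2 - l.2)) /h -scalerBl; congr (_ *: _).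
exists (l.2 + h); split.
  by apply: (belowP l) => //; rewrite addrC addKr.
by apply: (aboveP u) => //; rewrite dh.
Qed.

End Game.

(** * Truth is determined by finitely many terms *)

HB.instance Definition _ := gen_eqMixin term.

(** Each term t is affine in the variable of index i: its value is coef i t times
    that of the variable, plus that of rest i t. *)
Fixpoint coef (i : nat) (t : term) : rat :=
  match t with
  | Var j => (j == i)%:R
  | Zero => 0
  | Add t u => coef i t + coef i u
  | Scale q t => q * coef i t
  end.

Fixpoint rest (i : nat) (t : term) : term :=
  match t with
  | Var j => if j == i then Zero else Var j
  | Zero => Zero
  | Add t u => Add (rest i t) (rest i u)
  | Scale q t => Scale q (rest i t)
  end.

(** The zero of t as an affine function of the variable of index i; if the slope
    vanishes it is a harmless value, as 0 has inverse 0. *)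
Definition center (i : nat) (t : term) : term := Scale (- (coef i t)^-1) (rest i t).

Fixpoint term_subst (s : nat -> term) (t : term) : term :=
  match t with
  | Var j => s j
  | Zero => Zero
  | Add t u => Add (term_subst s t) (term_subst s u)
  | Scale q t => Scale q (term_subst s t)
  end.

Fixpoint rel_free (f : formula) : bool :=
  match f with
  | Rel _ _ _ => false
  | Neg f | All _ f | Ex _ f => rel_free f
  | And f g | Or f g | Imp f g => rel_free f && rel_free g
  | _ => true
  end.

Lemma rel_free_conj (F : nat -> formula) r : (forall i, rel_free (F i)) ->
  rel_free (conj_fo [seq F i | i <- r]).
Proof. by move=> FF; elim: r => //= i r ->; rewrite FF. Qed.

Lemma rel_free_exs vs f : rel_free (exs_fo vs f) = rel_free f.
Proof. by elim: vs. Qed.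

Lemma rel_free_alternation c n f : rel_free f -> rel_free (alternation c n f).
Proof.
move=> ff; rewrite /alternation rel_free_exs.
have cc i : rel_free (colored (c (+) odd i) (Var i.+2)).
  by rewrite /colored; case: ifP.
have lt_ok i : rel_free (Lt (Var i.+2) (Var i.+3)) by [].
apply/andP; split; apply/andP; split; first by [].
- exact: (rel_free_conj (iota 0 n) lt_ok).
- exact: (rel_free_conj (iota 0 n.+1) cc).
- exact: ff.
Qed.

Lemma rel_free_alternations c n : rel_free (alternations_exactly c n).
Proof.
apply/andP; split; first by case: c.
apply/andP; split; first exact: (@rel_free_alternation c n (Eq _ _)).
exact: (@rel_free_alternation c n.+1 (Or _ _)).
Qed.

Section Determined.
Variables (M : structure) (A : T_axioms M).
Local Notation V := (vec A).
Implicit Types (x y z c d g : V) (p q : V * V).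

Definition ev (rho : nat -> M) (t : term) : V := eval rho t.

Lemma ev_update rho i c t :
  ev (update rho i c) t = coef i t *: c + ev rho (rest i t).
Proof.
elim: t => [j| |t IHt u IHu|q t IHt]; rewrite /ev /=.
- rewrite /update; case: eqP => _ /=; first by rewrite scale1r; exact: (esym (addr0 c)).
  by rewrite scale0r; exact: (esym (add0r (rho j : V))).
- by rewrite scale0r; exact: (esym (add0r (0 : V))).
- rewrite -[LHS]/(ev (update rho i c) t + ev (update rho i c) u) IHt IHu.
  by rewrite scalerDl addrACA.
- by rewrite -[LHS]/(q *: ev (update rho i c) t) IHt scalerDr scalerA.
Qed.

Lemma ev_center rho i c t : coef i t != 0 ->
  ev (update rho i c) t = coef i t *: (c - ev rho (center i t)).
Proof.
move=> q0; rewrite ev_update.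
have -> : ev rho (center i t) = (- (coef i t)^-1) *: ev rho (rest i t) by [].
by rewrite scalerBr scalerA mulrN mulfV // scaleN1r opprK.
Qed.

Lemma ev_rest rho i c t : coef i t = 0 -> ev (update rho i c) t = ev rho (rest i t).
Proof. by move=> q0; rewrite ev_update q0 scale0r add0r. Qed.

Definition graph (Phi : seq term) (rho rho' : nat -> M) : seq (V * V) :=
  [seq (ev rho t, ev rho' t) | t <- Phi].

(** The data that the truth of a formula can depend on: signs, colours, and
    distances of valuations up to N, for the terms in Phi. *)
Definition similar Phi N (rho rho' : nat -> M) : Prop :=
  vsim N (graph Phi rho rho') /\
  forall t, t \in Phi -> same_sign (ev rho t) (ev rho' t).

Lemma mem_graph Phi rho rho' t : t \in Phi ->
  (ev rho t, ev rho' t) \in graph Phi rho rho'.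
Proof. by move=> h; apply/mapP; exists t. Qed.

Lemma similar_sub Phi N Psi N' rho rho' : {subset Phi <= Psi} -> (N <= N')%N ->
  similar Psi N' rho rho' -> similar Phi N rho rho'.
Proof.
move=> sub NN [h1 h2]; split; last by move=> t /sub; exact: h2.
apply: sim_le NN _ => p q /mapP[t /sub tP ->] /mapP[u /sub uP ->].
by apply: h1; exact: mem_graph.
Qed.

Lemma similar_sym Phi N rho rho' : similar Phi N rho rho' -> similar Phi N rho' rho.
Proof.
move=> [h1 h2]; split; last by move=> t /h2/same_sign_sym.
move=> p q /mapP[t tP ->] /mapP[u uP ->].
have [h3 h4] := h1 _ _ (mem_graph rho rho' tP) (mem_graph rho rho' uP).
by split=> [n nN|]; apply: iff_sym => //; exact: h3.
Qed.

(** Only valuations matter for vsim. *)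
Lemma vsim_val_eq N (L L' : seq (V * V)) : vsim N L ->
  (forall p, p \in L' -> exists w, [/\ w \in L, val_eq p.1 w.1 & val_eq p.2 w.2]) ->
  vsim N L'.
Proof.
move=> sL rep p q pL qL.
have [w [wL [a1 a2] [a3 a4]]] := rep p pL.
have [v [vL [b1 b2] [b3 b4]]] := rep q qL.
have ge := gap_eq (le := @val_le M A)
  (fun x y z => @val_le_trans M A y x z) (@vsuccP M A).
split=> [n nN|].
  rewrite (ge n _ _ _ _ a1 a2 b1 b2) (ge n _ _ _ _ a3 a4 b3 b4).
  exact: (sL w v wL vL).1.
rewrite (val_eq_P (conj a1 a2)) (val_eq_P (conj a3 a4)).
exact: (sL w w wL wL).2.
Qed.

(** As a term is a multiple of the difference between the variable and its center, it
    is enough to match these differences, by extend_point. The data required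
    beforehand concern the terms free of the variable and the differences of the
    centers. *)
Lemma similar_update Phi N i : exists Psi N',
  forall rho rho', similar Psi N' rho rho' ->
  forall c, exists d : V, similar Phi N (update rho i c) (update rho' i d).
Proof.
pose Psi := Zero :: [seq rest i t | t <- Phi] ++
  [seq Add (center i t) (Scale (-1) (center i u)) | t <- Phi, u <- Phi].
exists Psi, (2 * N + 3)%N => rho rho' [sV sS] c.
pose L := graph Psi rho rho'.
have oL : (0, 0) \in L by rewrite /L /graph /= mem_head.
have restL t : t \in Phi -> rest i t \in Psi.
  by move=> tP; rewrite in_cons mem_cat map_f ?orbT.
have CL p q : p \in graph [seq center i t | t <- Phi] rho rho' ->
    q \in graph [seq center i t | t <- Phi] rho rho' -> (p.1 - q.1, p.2 - q.2) \in L.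
  move=> /mapP[_ /mapP[t tP ->] ->] /mapP[_ /mapP[u uP ->] ->].
  have : Add (center i t) (Scale (-1) (center i u)) \in Psi.
    rewrite in_cons mem_cat; apply/orP; right; apply/orP; right.
    by apply/allpairsP; exists (t, u).
  have e r : ev r (center i t) - ev r (center i u) =
      ev r (Add (center i t) (Scale (-1) (center i u))).
    by rewrite -[RHS]/(ev r (center i t) + (-1) *: ev r (center i u)) scaleN1r.
  by rewrite /= !e; exact: mem_graph.
have sgL p : p \in L -> same_sign p.1 p.2 by move=> /mapP[t tP ->]; exact: sS.
have [d [g [g' [sg Hd]]]] := extend_point sV oL CL sgL c.
exists d.
have H t : t \in Phi ->
    same_sign (ev (update rho i c) t) (ev (update rho' i d) t) /\
    exists w, [/\ w \in (g, g') :: L, val_eq (ev (update rho i c) t) w.1 &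
      val_eq (ev (update rho' i d) t) w.2].
  move=> tP; have [q0|q0] := eqVneq (coef i t) 0.
    rewrite !ev_rest //; split; first exact: sS (restL t tP).
    exists (ev rho (rest i t), ev rho' (rest i t)); split; try exact: val_eq_refl.
    by rewrite in_cons mem_graph ?orbT //; exact: restL.
  rewrite !ev_center //.
  have := Hd (ev rho (center i t), ev rho' (center i t)).
  rewrite mem_graph ?map_f // => /(_ isT)[/= h1 [w [wL w1 w2]]].
  split; first exact: same_sign_scale.
  exists w; split=> //; [apply: val_eq_trans w1|apply: val_eq_trans w2];
    exact: val_eq_scale.
split; last by move=> t /H[].
by apply: vsim_val_eq sg _ => p /mapP[t tP ->] /=; exact: (H t tP).2.
Qed.

Definition determined (D : (nat -> M) -> Prop) : Prop :=
  exists Phi N, forall rho rho', similar Phi N rho rho' -> (D rho <-> D rho').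

Lemma determined_eq (D D' : (nat -> M) -> Prop) :
  (forall rho, D rho <-> D' rho) -> determined D -> determined D'.
Proof.
by move=> e [Phi [N h]]; exists Phi, N => rho rho' /h; rewrite -!e.
Qed.

Lemma determined_neg D : determined D -> determined (fun rho => ~ D rho).
Proof. by move=> [Phi [N h]]; exists Phi, N => rho rho' /h ->. Qed.

Lemma determined2 (op : Prop -> Prop -> Prop) D D' : determined D -> determined D' ->
  determined (fun rho => op (D rho) (D' rho)).
Proof.
move=> [Phi [N h]] [Phi' [N' h']]; exists (Phi ++ Phi'), (maxn N N') => rho rho' s.
have -> : D rho = D rho'.
  apply/propext/h/(similar_sub _ _ s); last exact: leq_maxl.
  by move=> t tP; rewrite mem_cat tP.
have -> // : D' rho = D' rho'.
apply/propext/h'/(similar_sub _ _ s); last exact: leq_maxr.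
by move=> t tP; rewrite mem_cat tP orbT.
Qed.

Lemma determined_ex i D : determined D ->
  determined (fun rho => exists c : M, D (update rho i c)).
Proof.
move=> [Phi [N h]]; have [Psi [N' H]] := similar_update Phi N i; exists Psi, N'.
suff K rho rho' : similar Psi N' rho rho' ->
    (exists c : M, D (update rho i c)) -> exists c : M, D (update rho' i c).
  by move=> rho rho' s; split; apply: K => //; exact: similar_sym.
by move=> s [c Dc]; have [d sd] := H _ _ s c; exists d; apply/(h _ _ sd).
Qed.

Lemma determined_all i D : determined D ->
  determined (fun rho => forall c : M, D (update rho i c)).
Proof.
move=> /determined_neg/(determined_ex i)/determined_neg; apply: determined_eq => rho.
split=> [n c|h [c]]; last exact.
by apply: contrapT => nD; apply: n; exists c.
Qed.

Lemma eval_subst (s : nat -> term) (rho : nat -> M) t :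
  eval rho (term_subst s t) = eval (fun i => eval rho (s i)) t.
Proof. by elim: t => //= [t -> u ->|q t ->]. Qed.

Lemma determined_subst (s : nat -> term) D : determined D ->
  determined (fun rho => D (fun i => eval rho (s i))).
Proof.
move=> [Phi [N h]]; exists [seq term_subst s t | t <- Phi], N => rho rho' [s1 s2].
apply: h; split.
  move: s1; rewrite /graph -map_comp; congr (vsim _ _); apply: eq_map => t /=.
  by rewrite /ev !eval_subst.
by move=> t tP; rewrite /ev -!eval_subst; apply: s2; exact: map_f.
Qed.

Lemma determined_sign t (Q : bool -> bool -> Prop) :
  determined (fun rho => Q (0 < ev rho t) (ev rho t < 0)).
Proof.
exists [:: t], 0%N => rho rho' [_ h].
by have [-> ->] := h t (mem_head _ _).
Qed.

Lemma determined_rel_free f : rel_free f -> determined (fun rho => sat rho f).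
Proof.
elim: f => [t u|t u|t|//|f IH|f IHf g IHg|f IHf g IHg|f IHf g IHg|i f IH|i f IH] /=.
- move=> _; apply: determined_eq
    (determined_sign (Add t (Scale (-1) u)) (fun a b => ~~ a && ~~ b)) => rho.
  rewrite -[ev rho _]/(ev rho t + (-1) *: ev rho u) scaleN1r vsub_gt0 vsub_lt0.
  split=> [|e]; last by rewrite /ev e ltxx.
  by rewrite -!leNgt => h; apply: (@le_anti _ V).
- move=> _; apply: determined_eq
    (determined_sign (Add t (Scale (-1) u)) (fun a b => b)) => rho.
  rewrite -[ev rho _]/(ev rho t + (-1) *: ev rho u) scaleN1r vsub_lt0.
  by apply: iff_sym; exact: rwP (vltP _ _).
- move=> _; exists [:: t], 0%N => rho rho' [h _].
  have tP := mem_graph rho rho' (mem_head t [::]).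
  exact: (h _ _ tP tP).2.
- by move/IH; exact: determined_neg.
- by move=> /andP[/IHf h /IHg h']; exact: (determined2 and h h').
- by move=> /andP[/IHf h /IHg h']; exact: (determined2 or h h').
- by move=> /andP[/IHf h /IHg h']; exact: (determined2 (fun a b => a -> b) h h').
- by move/IH; exact: determined_all.
- by move/IH; exact: determined_ex.
Qed.

(** By ax_R0 and ax_R, R_n is definable from the order and P by a formula in two
    variables, for which t and u are substituted. *)
Lemma determined_rel n t u : determined (fun rho => sat rho (Rel n t u)).
Proof.
pose s (i : nat) : term := if i is j.+1 then (if j is _.+1 then Zero else u) else t.
have [f ff Hf] : exists2 f, rel_free f &
    forall r : nat -> M, sat r f <-> RI n (r 0%N) (r 1%N).
  case: n => [|n].
    pose g i j := And (Or (Lt (Var i) (Var j)) (Eq (Var i) (Var j)))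
      (Or (itv_colored true (Var i) (Var j)) (itv_colored false (Var i) (Var j))).
    exists (Or (g 0%N 1%N) (g 1%N 0%N)) => // r.
    have E i j : (i != 9)%N -> (j != 9)%N ->
        sat r (g i j) <-> leI (r i) (r j) /\ RI 0 (r i) (r j).
      move=> i9 j9; have L b := @sat_itv_colored M r b i j i9 j9.
      rewrite /g sat_And; split=> -[ij H]; split=> //.
        by apply/(ax_R0 A) => //; case: H => h;
          [left; exact: (L true).1 h|right; exact: (L false).1 h].
      by case: ((ax_R0 A ij).1 H) => h;
        [left; exact: (L true).2 h|right; exact: (L false).2 h].
    rewrite -[sat r _]/(sat r (g 0%N 1%N) \/ sat r (g 1%N 0%N)) !E //.
    split=> [[[]//|[_ /(ax_R0_sym A)]//]|h].
    have [l|e|l] := ax_lt_total A (r 0%N) (r 1%N).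
    - by left; split=> //; left.
    - by left; split=> //; right.
    - by right; split; [left|exact: ax_R0_sym].
  exists (And (Lt (Var 0) (Var 1)) (Or (alternations_exactly true n.+1)
      (alternations_exactly false n.+1))).
    apply/andP; split; first by [].
    apply/andP; split; first exact: (rel_free_alternations true n.+1).
    exact: (rel_free_alternations false n.+1).
  move=> r; rewrite (ax_R A (isT : (0 < n.+1)%N)).
  by rewrite -!sat_alternations.
apply: determined_eq (determined_subst s (determined_rel_free ff)) => rho.
exact: Hf.
Qed.

Lemma determined_sat f : determined (fun rho => sat rho f).
Proof.
elim: f => [t u|t u|t|n t u|f IH|f IHf g IHg|f IHf g IHg|f IHf g IHg|i f IH|i f IH] /=.
- exact: (@determined_rel_free (Eq t u)).
- exact: (@determined_rel_free (Lt t u)).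
- exact: (@determined_rel_free (InP t)).
- exact: determined_rel.
- exact: determined_neg.
- exact: (determined2 and IHf IHg).
- exact: (determined2 or IHf IHg).
- exact: (determined2 (fun a b => a -> b) IHf IHg).
- exact: (@determined_all i (fun r => sat r f) IH).
- exact: (@determined_ex i (fun r => sat r f) IH).
Qed.

(** * Definable sets are locally constant off a finite set *)

(** Here x + z is above x/2, which has the valuation of x, and by the ultrametric
    inequality its own valuation is not larger. *)
Lemma near_pos x z : 0 < x -> vabs z < 2%:R^-1 *: x -> 0 < x + z /\ val_eq (x + z) x.
Proof.
move=> x0 zx; pose h : V := 2%:R^-1 *: x.
have h0 : 0 < h by exact: vscale_gt0.
have hx : val_eq h x by exact: val_eq_scale.
have xhh : x = h + h.
  by rewrite /h -scalerDl (_ : 2%:R^-1 + 2%:R^-1 = 1) ?scale1r.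
have hz : 0 < h + z.
  rewrite -[z]opprK vsub_gt0; apply: le_lt_trans zx; rewrite -vabsN; exact: le_vabs.
have hxz : h < x + z.
  by rewrite -(vltD2r (- h)) subrr {1}xhh -[h + h + z]addrA [h + (h + z)]addrC addrK.
split; first exact: lt_trans h0 hxz.
split.
  apply: val_le_add; first exact: val_lexx.
  apply: val_le_trans hx.1; apply: val_le_abs.
  by rewrite [vabs h]vabs_id ltW.
apply: val_le_trans hx.2 (val_le_abs _).
by rewrite !vabs_id ?(ltW h0) ?(ltW (lt_trans h0 hxz)) // ltW.
Qed.

Lemma near_sim x z :
  vabs z < 2%:R^-1 *: vabs x -> same_sign (x + z) x /\ val_eq (x + z) x.
Proof.
have [h|h|->] := ltgtP x 0.
- rewrite (vabs_le0 (ltW h)) -(vabsN z) => zx.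
  have [|h1 h2] := near_pos _ zx; first by rewrite voppr_gt0.
  split.
    by apply/same_signN; rewrite opprD; apply: same_sign_pos; rewrite ?voppr_gt0.
  apply: val_eq_trans (val_eqN x); apply: val_eq_trans h2.
  by rewrite -opprD; apply: val_eq_sym; exact: val_eqN.
- rewrite (vabs_id (ltW h)) => /(near_pos h)[h1 h2]; split=> //.
  exact: same_sign_pos.
- by rewrite (vabs_id (lexx _)) scaler0 ltNge vabs_ge0.
Qed.

Lemma vabs_lt x (e : V) : - e < x -> x < e -> vabs x < e.
Proof.
by move=> h1 h2; rewrite /vabs; case: ifP => // _; rewrite -[e]opprK vltN2.
Qed.

Lemma seq_lower_bound (s : seq V) : (forall x, x \in s -> 0 < x) ->
  exists2 e : V, 0 < e & forall x, x \in s -> e <= x.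
Proof.
elim: s => [|a s IH] h; first by have [e e0 _] := ex_pos_val0 A; exists e.
have [|e e0 es] := IH; first by move=> x xs; apply: h; rewrite in_cons xs orbT.
have a0 : 0 < a by apply: h; exact: mem_head.
have [ae|ea] := leP a e.
  exists a => // x; rewrite in_cons => /orP[/eqP -> //|/es]; exact: le_trans.
by exists e => // x; rewrite in_cons => /orP[/eqP ->|/es //]; exact: ltW.
Qed.

(** The distance e is half the least distance of a to a center, so that no affine
    function in Phi changes sign or valuation within e of a. *)
Lemma similar_near Phi N rho i (a : V) :
  (forall t, t \in Phi -> a <> ev rho (center i t)) ->
  exists e : V, 0 < e /\ forall b : V, a - e < b -> b < a + e ->
    similar Phi N (update rho i a) (update rho i b).
Proof.
move=> na.
have [|e e0 He] := @seq_lower_bound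
    [seq 2%:R^-1 *: vabs (a - ev rho (center i t)) | t <- Phi].
  move=> x /mapP[t tP ->]; apply: vscale_gt0 => //.
  have : a - ev rho (center i t) != 0 by rewrite subr_eq0; apply/eqP; exact: na.
  by rewrite lt_def vabs_ge0 andbT /vabs; case: ifP; rewrite ?oppr_eq0.
exists e; split=> // b ab1 ab2.
have K t : t \in Phi -> same_sign (ev (update rho i a) t) (ev (update rho i b) t) /\
    val_eq (ev (update rho i b) t) (ev (update rho i a) t).
  move=> tP; have [q0|q0] := eqVneq (coef i t) 0.
    by rewrite !ev_rest //; split=> //; exact: val_eq_refl.
  rewrite !ev_center //.
  have -> : b - ev rho (center i t) = (a - ev rho (center i t)) + (b - a).
    exact: vsub_chainC.
  have [|h1 h2] := @near_sim (a - ev rho (center i t)) (b - a).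
    apply: lt_le_trans (He _ (map_f _ tP)); apply: vabs_lt.
      by rewrite -(vltD2r a) subrK addrC.
    by rewrite -(vltD2r a) subrK addrC.
  split; first by apply: same_sign_scale; exact: same_sign_sym.
  apply: val_eq_trans (val_eq_scale _ q0) (val_eq_trans h2 _).
  by apply: val_eq_sym; exact: val_eq_scale.
split; last by move=> t /K[].
have diag : vsim N (graph Phi (update rho i a) (update rho i a)).
  by move=> p q /mapP[t _ ->] /mapP[u _ ->].
apply: vsim_val_eq diag _ => p /mapP[t tP ->].
exists (ev (update rho i a) t, ev (update rho i a) t).
by split; [exact: mem_graph|exact: val_eq_refl|exact: (K t tP).2].
Qed.

Lemma definable_interior (X : set M) : infinite_set X -> definable X ->
  (order_interior X !=set0)%classic.
Proof.
move=> Xinf [f [rho eX]].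
have [Phi [N H]] := determined_sat f.
pose bad : seq V := [seq ev rho (center 0 t) | t <- Phi].
have [a Xa na] : exists2 a : V, X a & a \notin bad.
  apply: contrapT => nex; apply: Xinf; apply: (@sub_finite_set V X [set` bad]%classic).
    by move=> x Xx; apply: contrapT => /negP xb; apply: nex; exists x.
  exact: finite_seq.
have [|e [e0 He]] := @similar_near Phi N rho 0 a.
  by move=> t tP ae; move/negP: na; apply; rewrite ae; apply/mapP; exists t.
exists (a : M), (oo_interval (Some (a - e : M)) (Some (a + e : M))); split.
- by move=> c h; exists (Some (a - e : M)), (Some (a + e : M)); split.
- move=> b [/vltP lb /vltP bu]; rewrite eX /=.
  by apply/(H _ _ (He b lb bu)); move: Xa; rewrite eX.
- split; apply/vltP.
    by rewrite -(vltD2r e) subrK -{1}[a]addr0 ![a + _]addrC vltD2r.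
  by rewrite -{1}[a]addr0 ![a + _]addrC vltD2r.
Qed.

End Determined.

(** * A model in which P has infinitely many components *)

Section Model.
Implicit Types (p q w x y : {poly rat}).

Definition lex_lt p q : Prop := 0 < lead_coef (q - p).

(** The degree, with the sign of the leading coefficient. Constants have level 0
    whatever their sign, so that they form a single fibre. *)
Definition level p : int :=
  if 0 < lead_coef p then (size p).-1%:Z else - (size p).-1%:Z.

Definition even_deg p : Prop := ~~ odd (size p).-1.

Lemma lead_coefD_gt0 p q : 0 < lead_coef p -> 0 < lead_coef q -> 0 < lead_coef (p + q).
Proof.
wlog pq : p q / (size q <= size p)%N => [H p0 q0|p0 q0].
  by case: (leqP (size q) (size p)) => [|/ltnW] h; [|rewrite addrC]; exact: H.
move: pq; rewrite leq_eqVlt => /orP[/eqP e|h]; last by rewrite lead_coefDl.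
have c0 : 0 < (p + q)`_(size p).-1.
  by rewrite coefD addr_gt0 // -e.
suff s : size (p + q) = size p by rewrite lead_coefE s.
apply/eqP; rewrite eqn_leq; apply/andP; split.
  by rewrite (leq_trans (size_polyD _ _)) // e maxnn.
rewrite leqNgt; apply/negP => h.
have hs : (size (p + q)%R <= (size p).-1)%N.
  by rewrite -ltnS (leq_trans h) // leqSpred.
by move: c0; rewrite nth_default // ltxx.
Qed.

Lemma lex_ltD2r z x y : lex_lt (x + z) (y + z) <-> lex_lt x y.
Proof. by rewrite /lex_lt opprD addrACA subrr addr0. Qed.

Lemma lex_lt_trans x y z : lex_lt x y -> lex_lt y z -> lex_lt x z.
Proof.
rewrite /lex_lt => xy yz; have := lead_coefD_gt0 yz xy.
by rewrite addrA subrK.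
Qed.

Lemma lex_lt_irr x : ~ lex_lt x x.
Proof. by rewrite /lex_lt subrr lead_coef0 ltxx. Qed.

Lemma lex_lt_total x y : [\/ lex_lt x y, x = y | lex_lt y x].
Proof.
have [h|h|h] := ltgtP 0 (lead_coef (y - x)).
- exact: Or31.
- by apply: Or33; rewrite /lex_lt -opprB lead_coefN oppr_gt0.
- by apply: Or32; apply/esym/eqP; rewrite -subr_eq0 -lead_coef_eq0 -h.
Qed.

Lemma levelN p : level (- p) = - level p.
Proof.
rewrite /level lead_coefN size_polyN oppr_gt0.
have [h|h|h] := ltgtP (lead_coef p) 0; rewrite ?opprK //.
by move/eqP: h; rewrite lead_coef_eq0 => /eqP ->; rewrite size_poly0.
Qed.

Lemma even_degE p : even_deg p <-> ~~ odd `|level p|%N.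
Proof. by rewrite /level /even_deg; case: ifP; rewrite ?abszN. Qed.

(** If the degrees differ, the polynomial of larger degree decides the sign of the
    difference; if they agree and the levels do not, the signs are opposite and
    nothing cancels. *)
Lemma level_lt p q : level q < level p -> lex_lt q p.
Proof.
move=> h; rewrite /lex_lt.
have lN : lead_coef (- q) = - lead_coef q by rewrite lead_coefN.
have szl (r : {poly rat}) : lead_coef r = 0 -> (size r).-1 = 0%N.
  by move/eqP; rewrite lead_coef_eq0 => /eqP ->; rewrite size_poly0.
case: (leqP (size p) (size q)) => spq; last first.
  rewrite lead_coefDl ?size_polyN //; rewrite ltNge; apply/negP => p0.
  by move: h; rewrite /level (le_gtF p0); case: ifP; lia.
have q0 : lead_coef q < 0.
  have [//|q0|/szl q0] := ltgtP (lead_coef q) 0; move: h; rewrite /level.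
    by rewrite q0; case: ifP; lia.
  by case: ifP; case: ifP; lia.
move: spq; rewrite leq_eqVlt => /orP[/eqP spq|spq]; last first.
  by rewrite addrC lead_coefDl ?size_polyN // lN oppr_gt0.
apply: lead_coefD_gt0; last by rewrite lN oppr_gt0.
rewrite ltNge; apply/negP => p0.
by move: h; rewrite /level (le_gtF p0) (lt_gtF q0) spq ltxx.
Qed.

Lemma level_le p q : lex_lt p q \/ p = q -> level p <= level q.
Proof.
move=> h; rewrite leNgt; apply/negP => /level_lt h'.
by case: h => [/lex_lt_trans/(_ h')|e]; [|move: h'; rewrite e]; exact: lex_lt_irr.
Qed.

Lemma level_surj (m : int) : exists p, level p = m.
Proof.
have H n : level 'X^n = n%:Z by rewrite /level lead_coefXn ltr01 size_polyXn.
case: m => n; first by exists 'X^n.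
by exists (- ('X^(n.+1) : {poly rat})); rewrite levelN H NegzE.
Qed.

Lemma levelZ (r : rat) p : 0 < r -> level (r *: p) = level p.
Proof.
by move=> r0; rewrite /level lead_coefZ size_scale ?gt_eqF // pmulr_rgt0.
Qed.

(** If p <= q then p + p <= p + q <= q + q, and doubling preserves levels. *)
Lemma levelD p q : level p = level q -> level (p + q) = level p.
Proof.
wlog pq : p q / lex_lt p q \/ p = q => [H e|e].
  have [h|h|h] := lex_lt_total p q; [by apply: H; [left|]|by apply: H; [right|]|].
  by rewrite addrC e; apply: H; [left|].
have l2 r : level (r + r) = level r.
  by rewrite -mulr2n -scaler_nat levelZ.
have D z : lex_lt (p + z) (q + z) \/ p + z = q + z.
  by case: pq => [h|->]; [left; apply/lex_ltD2r|right].
apply/eqP; rewrite eq_le {1}e -{1}(l2 q) -[in X in _ && X](l2 p).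
rewrite (level_le (D q)) /= [p + q]addrC; exact: level_le (D p).
Qed.

(** The difference is between -1 and 1, so it has level 0 and is a constant. *)
Lemma size_near x w : lex_lt (x - 1) w -> lex_lt w (x + 1) -> (size w).-1 = (size x).-1.
Proof.
move=> h1 h2.
have l1 : level 1 = 0 by rewrite /level lead_coef1 size_poly1.
have lwx : level (w - x) = 0.
  have a1 : lex_lt (- 1) (w - x) by apply/(lex_ltD2r x); rewrite subrK addrC.
  have a2 : lex_lt (w - x) 1 by apply/(lex_ltD2r x); rewrite subrK addrC.
  have := level_le (or_introl a1); have := level_le (or_introl a2).
  by rewrite levelN l1; lia.
have swx : (size (w - x)).-1 = 0%N.
  move: lwx; rewrite /level.
  by case: ifP => _; [|move/eqP; rewrite oppr_eq0 => /eqP] => -[].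
have -> : w = x + (w - x) by rewrite addrC subrK.
case: (leqP (size x) 1) => sx; last by rewrite size_polyDl //; lia.
by have := size_polyD x (w - x); lia.
Qed.

(** The number of alternations is a notion about structures that depends on the
    order and P only. It is taken in a structure with empty relations, and serves to
    interpret the relations of the model. *)
Definition poly_base : structure :=
  @Structure {poly rat} 0 +%R (fun r p => r *: p) lex_lt even_deg (fun _ _ _ => False).

Definition monochrome x y : Prop :=
  (@cc_interval poly_base x y `<=` @PI poly_base)%classic \/
  (@cc_interval poly_base x y `<=` ~` @PI poly_base)%classic.

Definition poly_rel n x y : Prop :=
  if n is 0%N then
    (@leI poly_base x y /\ monochrome x y) \/ (@leI poly_base y x /\ monochrome y x)
  else lex_lt x y /\ (@alternations poly_base true n x y \/
                   @alternations poly_base false n x y).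

Definition poly_model : structure :=
  @Structure {poly rat} 0 +%R (fun r p => r *: p) lex_lt even_deg poly_rel.

Lemma colorI_level c p q : level p = level q ->
  @colorI poly_model c p -> @colorI poly_model c q.
Proof.
by move=> e /colorIP/= h; apply/colorIP => /=; rewrite even_degE -e -even_degE.
Qed.

(** If the levels of x and y differ, the interval has an element whose level is the
    successor of that of x, hence of the other colour. *)
Lemma level_monochrome c x y : lex_lt x y \/ x = y ->
  (@cc_interval poly_model x y `<=` colorI c)%classic -> level x = level y.
Proof.
move=> xy sub; have := level_le xy; rewrite le_eqVlt => /orP[/eqP //|lt].
have [w lw] := level_surj (level x + 1).
have xw : lex_lt x w by apply: level_lt; lia.
have [z [xz lz]] : exists z, @cc_interval poly_model x y z /\ level z = level x + 1.
  have [e|ne] := eqVneq (level y) (level x + 1).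
    by exists y; split=> //; split=> //; right.
  by exists w; split=> //; split; left=> //; apply: level_lt; lia.
have /colorIP/= h1 : @colorI poly_model c x by apply: sub; split=> //; right.
have /colorIP/= h2 := sub z xz.
have : even_deg x <-> even_deg z by rewrite h1 h2.
by rewrite !even_degE lz => -[]; lia.
Qed.

Lemma level_between x y w : level x = level y ->
  @cc_interval poly_model x y w -> level w = level x.
Proof. by move=> e [/level_le h1 /level_le h2]; lia. Qed.

(** Two changes of colour would raise the level by 2. *)
Lemma poly_rel_succ x y : level y = level x + 1 -> poly_rel 1 x y.
Proof.
move=> e; have xy : lex_lt x y by apply: level_lt; lia.
split=> //.
suff H (c : bool) : (even_deg x <-> c) -> @alternations poly_base c 1 x y.
  case E : (~~ odd (size x).-1); [left|right]; apply: H; rewrite /even_deg E; split=> //.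
move=> xc; split; first exact/colorIP.
  exists (fun i => if i == 0%N then x else y); split=> //; split=> //.
    by case.
  case=> [|[|]] //= _; first by rewrite addbF.
  rewrite addbT even_degE e; move: xc; rewrite even_degE.
  by case: (c) => -[]; split; lia.
move=> [s [[s0 slt sP] s2]].
have l1 := level_le (or_introl (slt 0%N isT)).
have l2 := level_le (or_introl (slt 1%N isT)).
have l3 := level_le s2.
move: (sP 0%N isT) (sP 1%N isT) (sP 2%N isT); rewrite s0 in l1 *; rewrite /= => _.
rewrite !even_degE.
move: xc; rewrite even_degE addbT addbF.
by case: (c) => -[? ?] [? ?] [? ?]; lia.
Qed.

Lemma poly_axioms : T_axioms poly_model.
Proof.
have ltT : forall x y z : poly_model, ltI x y -> ltI y z -> ltI x z := @lex_lt_trans.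
have tot : forall x y : poly_model, [\/ ltI x y, x = y | ltI y x] := @lex_lt_total.
split.
- exact: addrA.
- exact: addrC.
- exact: add0r.
- by move=> x; exists (- (x : {poly rat})); exact: subrr.
- by exists (1 : {poly rat}); apply/eqP; exact: oner_neq0.
- move=> n n0 x; exists (n%:R^-1 *: (x : {poly rat})).
  rewrite -[LHS]/(iter n (+%R (n%:R^-1 *: (x : {poly rat}))) 0) iter_addr_0.
  by rewrite -scaler_nat scalerA mulfV ?scale1r // pnatr_eq0 -lt0n.
- exact: lex_lt_irr.
- exact: ltT.
- exact: tot.
- by move=> x y z h; apply/lex_ltD2r.
- exact: scale1r.
- exact: scalerA.
- by move=> q r x; exact: scalerDl.
- by move=> q x y; exact: scalerDr.
- by rewrite /= /even_deg size_poly0.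
- move=> x y /(addr0_eq (V := {poly rat})) <-.
  by rewrite /= /even_deg size_polyN.
- move=> c x cx.
  have xm : lex_lt (x - 1) x by rewrite /lex_lt opprB addrC subrK lead_coef1.
  have xp : lex_lt x (x + 1) by rewrite /lex_lt addrC addKr lead_coef1.
  exists (Some (x - 1 : poly_model)), (Some (x + 1 : poly_model)).
  split=> // w [/= h1 h2].
  have sw := size_near h1 h2.
  by move/colorIP: cx => /= cx; apply/colorIP; rewrite /= /even_deg sw.
- move=> c q r q0 r0 x y xy sub.
  have e := level_monochrome xy sub.
  have cx : @colorI poly_model c x by apply: sub; split; [right|].
  have lz : level (q *: (x : {poly rat}) + r *: (y : {poly rat})) = level x.
    by rewrite levelD !levelZ.
  have K u v : level u = level x -> level v = level x ->
      (@cc_interval poly_model u v `<=` colorI c)%classic.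
    move=> lu lv w /level_between h; apply: colorI_level cx.
    by rewrite h ?lu ?lv.
  by split; apply/(same_componentP _ _ _ ltT tot); split; apply: K.
- by move=> x y [h|h]; [right|left].
- move=> x y xy; split=> [[[_ m]|[yx m]]|m] //; last by left.
  have e : x = y.
    case: xy => // xy; case: yx => // yx.
    by case: (lex_lt_irr (lex_lt_trans xy yx)).
  by rewrite -e in m *.
- by case.
- move=> x _; have [y ly] := level_surj (level x + 1); exists y.
  exact: poly_rel_succ.
- move=> x _; have [y ly] := level_surj (level x - 1); exists y.
  by apply: poly_rel_succ; rewrite ly subrK.
Qed.

(** Among n + 1 even powers of X two lie in the same of n convex sets, which then
    contains an odd power. *)
Lemma poly_not_finite_union : ~ finite_union_of_convex (@PI poly_model).
Proof.
move=> [n [C [Cc eP]]].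
have evP (i : nat) : @PI poly_model 'X^(i.*2).
  by rewrite /= /even_deg size_polyXn /= odd_double.
have sel (i : 'I_n.+1) : exists j : 'I_n, C j 'X^(i.*2).
  by have := evP i; rewrite eP => -[j _ Cj]; exists j.
have [f Cf] := choice sel.
have [i [j [ij fij]]] : exists i j : 'I_n.+1, (i < j)%N /\ f i = f j.
  have /injectivePn[i [j ij fij]] : ~~ injectiveb f.
    by apply/negP => /injectiveP/leq_card; rewrite !card_ord ltnn.
  case: (ltngtP i j) => [h|h|/val_inj e]; [by exists i, j|by exists j, i|].
  by rewrite e eqxx in ij.
have Xlt (a b : nat) : (a < b)%N -> lex_lt 'X^a 'X^b.
  by move=> ab; apply: level_lt; rewrite /level !lead_coefXn ltr01 !size_polyXn.
have : @PI poly_model 'X^(i.*2.+1).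
  rewrite eP; exists (f i) => //.
  apply: (Cc (f i) _ _ (Cf i)); first by rewrite fij; exact: Cf.
  split; left; apply: Xlt; lia.
by rewrite /= /even_deg size_polyXn /= odd_double.
Qed.

End Model.

Theorem corollary5p4 :
  (forall M : structure, models M T ->
   forall X : set M, infinite_set X -> definable X ->
   (order_interior X !=set0)%classic) /\
  ~ weakly_o_minimal T.
Proof.
split=> [M /models_TP A X|H]; first exact: (definable_interior A).
apply: poly_not_finite_union; apply: H; first exact/models_TP/poly_axioms.
by exists (InP (Var 0)), (fun=> zeroI).
Qed.
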